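(* Let $m\in\mathbb N$, $r>0$, $y_1,\dots,y_m\in(0,\infty)$, and let $L=(L^1,\dots,L^m)$ be an $m$-dimensional L\'evy process such that $L^1,\dots,L^m$ are negative subordinators, with jump measure $\Pi$ concentrated on $(-\infty,0)^m$ and drift vector $(a_1,\dots,a_m)$ with $a_i\leq0$ for all $i$. Put $$c_i=y_i\left(r-a_i-\int_{(-\infty,0)^m}(e^{z_i}-1)\,\Pi(dz)\right),\qquad i=1,\dots,m.$$ Then the stopping time $$\tau^*=\inf\left\{t\geq0:\ \sum_{i=1}^mc_ie^{L^i_t}\leq r\right\}$$ is optimal for the optimal investment problem $$\sup_\tau E\left(e^{-r\tau}\left(1-y_1e^{L^1_\tau}-\dots-y_me^{L^m_\tau}\right)\right),$$ i.e. it attains the supremum over all stopping times $\tau$. Moreover, for every $T\in(0,\infty)$, $\min\{\tau^*,T\}$ is optimal for the same problem with time horizon $T$, i.e. it attains the supremum over all stopping times $\tau\leq T$.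
   Context: $L_0=0$. A negative subordinator is a real-valued L\'evy process with non-increasing sample paths; thus $L$ has no Gaussian part, $\int\min\{1,|z|\}\,\Pi(dz)<\infty$, and $L_t=(a_1,\dots,a_m)t+\sum_{0<s\le t}\Delta L_s$, where the jumps $\Delta L_s$ are governed by $\Pi$. Stopping times are with respect to the filtration generated by $L$ and may take the value $\infty$; on $\{\tau=\infty\}$ the payoff is the limit $0$. Convention $\inf\emptyset=\infty$. *)

(* Defs.v *)
From HB Require Import structures.
From mathcomp Require Import all_boot all_order all_algebra.
From mathcomp Require Import all_classical all_reals all_analysis.

Set Implicit Arguments.
Unset Strict Implicit.
Unset Printing Implicit Defensive.
Import Order.TTheory GRing.Theory Num.Theory.
Import numFieldNormedType.Exports.
Local Open Scope classical_set_scope.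
Local Open Scope ring_scope.

(* An m-dimensional process is given by its coordinates [L i t w]: coordinate
   [i], time [t], scenario [w].  Only the times [0 <= t] are meaningful; no
   definition below looks at the values of [L] at negative times. *)

Definition increment (T : Type) (R : realType) (m : nat)
    (L : 'I_m -> R -> T -> R) (s t : R) (w : T) : m.-tuple R :=
  [tuple L i t w - L i s w | i < m].

Definition jump (T : Type) (R : realType) (m : nat)
    (L : 'I_m -> R -> T -> R) (s : R) (w : T) : m.-tuple R :=
  [tuple L i s w - lim (L i u w @[u --> s^'-]) | i < m].

(* The raw (uncompleted) sigma-algebra sigma(L_s : 0 <= s <= t). *)
Definition natural_filtration (T : Type) (R : realType) (m : nat)
    (L : 'I_m -> R -> T -> R) (t : R) : set (set T) :=
  <<s [set A | exists (i : 'I_m) (s : R) (B : set R),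
         [/\ 0 <= s <= t, measurable B & A = L i s @^-1` B]] >>.

Definition stopping_time (T : Type) (R : realType) (m : nat)
    (L : 'I_m -> R -> T -> R) (tau : T -> \bar R) : Prop :=
  (forall w, (0 <= tau w)%E) /\
  (forall t : R, 0 <= t ->
     natural_filtration L t [set w | (tau w <= t%:E)%E]).

Record levy_process (d : measure_display) (T : measurableType d)
    (R : realType) (P : probability T R) (m : nat)
    (L : 'I_m -> R -> T -> R) : Prop := LevyProcess {
  levy_measurable : forall i (t : R), 0 <= t -> measurable_fun [set: T] (L i t) ;
  levy_start0 : forall i w, L i 0 w = 0 ;
  levy_right_continuous : forall i w (t : R), 0 <= t ->
    L i u w @[u --> t^'+] --> L i t w ;
  levy_left_limits : forall i w (t : R), 0 < t -> cvg (L i u w @[u --> t^'-]) ;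
  levy_stationary : forall (s h : R) (B : set (m.-tuple R)),
    0 <= s -> 0 <= h -> measurable B ->
    P (increment L s (s + h) @^-1` B) = P (increment L 0 h @^-1` B) ;
  levy_independent : forall (s t : R) (A : set T) (B : set (m.-tuple R)),
    0 <= s -> s <= t -> natural_filtration L s A -> measurable B ->
    P (A `&` increment L s t @^-1` B) = (P A * P (increment L s t @^-1` B))%E
}.

Definition negative_subordinator (d : measure_display) (T : measurableType d)
    (R : realType) (P : probability T R) (X : R -> T -> R) : Prop :=
  levy_process P (fun _ : 'I_1 => X) /\
  (forall w s t, 0 <= s -> s <= t -> X t w <= X s w).

(* The (Levy) jump measure of L: Pi B is the expected number of nonzero jumps
   with values in B during one unit of time. *)
Definition is_jump_measure (d : measure_display) (T : measurableType d)
    (R : realType) (P : probability T R) (m : nat) (L : 'I_m -> R -> T -> R)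
    (Pi : {measure set (m.-tuple R) -> \bar R}) : Prop :=
  forall B : set (m.-tuple R), measurable B ->
    Pi B = (\int[P]_w counting
      [set s : R | [/\ (0 < s <= 1)%R, jump L s w != [tuple 0%R | i < m]
                     & B (jump L s w)]])%E.

(* Almost surely L_t = a t + \sum_(0 < s <= t) Delta L_s for all t >= 0.  As
   [\esum] is meant for nonnegative terms and the jumps of negative
   subordinators are nonpositive, the sum of the jumps is written as
   minus the sum of their opposites. *)
Definition is_drift (d : measure_display) (T : measurableType d)
    (R : realType) (P : probability T R) (m : nat) (L : 'I_m -> R -> T -> R)
    (a : 'I_m -> R) : Prop :=
  {ae P, forall w, forall (i : 'I_m) (t : R), 0 <= t ->
    (L i t w)%:E = ((a i * t)%:E
      - \esum_(s in `]0%R, t]%classic) (- tnth (jump L s w) i)%:E)%E}.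

Definition negative_orthant (R : realType) (m : nat) : set (m.-tuple R) :=
  [set z | forall i, tnth z i < 0].
Arguments negative_orthant {R m}.

Definition euclidean_norm (R : realType) (m : nat) (z : m.-tuple R) : R :=
  Num.sqrt (\sum_(i < m) tnth z i ^+ 2).

Definition threshold_coef (R : realType) (m : nat) (r : R)
    (y a : 'I_m -> R) (Pi : {measure set (m.-tuple R) -> \bar R})
    (i : 'I_m) : R :=
  y i * (r - a i - \int[Pi]_(z in negative_orthant) (expR (tnth z i) - 1)).

(* [ereal_inf set0 = +oo]. *)
Definition threshold_time (T : Type) (R : realType) (m : nat) (r : R)
    (c : 'I_m -> R) (L : 'I_m -> R -> T -> R) (w : T) : \bar R :=
  ereal_inf [set t%:E | t in
    [set t : R | 0 <= t /\ \sum_(i < m) c i * expR (L i t w) <= r]].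

Definition payoff (T : Type) (R : realType) (m : nat) (r : R)
    (y : 'I_m -> R) (L : 'I_m -> R -> T -> R) (tau : T -> \bar R) (w : T) : R :=
  if tau w is t%:E
  then expR (- (r * t)) * (1 - \sum_(i < m) y i * expR (L i t w))
  else 0.

Definition optimal_among (X : Type) (R : realType) (S : set X)
    (J : X -> \bar R) (x : X) : Prop :=
  S x /\ J x = ereal_sup (J @` S).

(* Main.v *)
Require Import Defs.
From HB Require Import structures.
From mathcomp Require Import all_boot all_order all_algebra.
From mathcomp Require Import ring lra.
From mathcomp Require Import all_classical all_reals all_analysis.
From mathcomp Require Import measurable_realfun.
Import Order.TTheory GRing.Theory Num.Theory.
Import numFieldNormedType.Exports HBNNSimple.
Local Open Scope classical_set_scope.
Local Open Scope ring_scope.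
Set Implicit Arguments.
Unset Strict Implicit.
Unset Printing Implicit Defensive.

(** Write [E exp (L^i_t) = exp (- phi_i t)].  The increment of the discounted gain
    [G_t = e^(- r t) (1 - \sum_i y_i e^(L^i_t))] over a grid cell [[t, t + h]] has, given
    the past, mean [h e^(- r t) (\sum_i y_i (r + phi_i) e^(L^i_t) - r) + O(h^2)].  The
    bracket is nonincreasing in [t] and [tau_star] is the first time at which it is [<= 0]
    (the monotone case of optimal stopping), so replacing any stopping time by [tau_star]
    loses at most [O(h)] on a fixed horizon; the mesh then tends to 0.

    To identify [phi_i = - a_i + \int (1 - e^(z_i)) Pi(dz)], note that
    [2^k (1 - E exp (L^i_(2^-k)))] tends to [phi_i] and is, by stationarity, the mean of the
    sum of [1 - exp] over the increments of [L^i] on the dyadic grid of [[0, 1]].  These sums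
    increase with [k] (subadditivity of [1 - e^(- x)]) to
    [- a_i + \sum_(s <= 1) (1 - exp (Delta L^i_s))], whose mean is computed with [Pi]. *)

(** * Dyadic sums along a path with drift and jumps *)

(** Two obstacles shape the computation of the Laplace exponent. A sum over jump times has an
    uncountable index set and is not visibly measurable in the scenario; and [is_jump_measure] only
    speaks of numbers of jumps with values in a given set. Measurability is obtained for Lipschitz
    [f], whose jump sum is a limit of dyadic sums, and then for the number of jumps above a level
    [v > 0], whose indicator is an increasing limit of Lipschitz ramps. The means of these counts
    are values of [Pi], and a discrete layer-cake formula recovers the integral of [1 - exp] from
    them. As the meshes are [2^-k], [phi_i] arises by extracting [2^k]-th roots of [E exp (L^i_1)].
    In the stopping part a time [tau] is rounded up to the grid: going on at a grid point [t] is the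
    event [t < tau], known at time [t], and right-continuity gives back the gain at [tau]. The
    finite horizon uses the same comparison: before [T] the time [min (tau_star, T)] goes on exactly
    when the bracket is positive, and from [T] on every competitor has stopped. *)

Lemma big_double (V : nmodType) (F : nat -> V) n :
  \sum_(j < n.*2) F j = \sum_(j < n) (F j.*2 + F j.*2.+1).
Proof.
elim: n => [|n IH]; first by rewrite !big_ord0.
by rewrite doubleS !big_ord_recr /= IH addrA.
Qed.

Lemma cvg_big_sum (R : realType) (I : Type) (s : seq I) (U : Type)
    (F : set_system U) (FF : Filter F) (f : I -> U -> R) (l : I -> R) :
  (forall i, f i x @[x --> F] --> l i) ->
  \sum_(i <- s) f i x @[x --> F] --> \sum_(i <- s) l i.
Proof.
move=> fl; elim: s => [|i s IH].
  by rewrite big_nil; under eq_fun do rewrite big_nil; exact: cvg_cst.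
by rewrite big_cons; under eq_fun do rewrite big_cons; exact: cvgD.
Qed.

Lemma exp2n_gt0 (R : realType) k : 0 < 2 ^+ k :> R.
Proof. by rewrite exprn_gt0. Qed.

Lemma cvg_inv_exp2 (R : realType) : (2 ^+ k)^-1 @[k --> \oo] --> (0 : R).
Proof.
have := @cvg_geometric R 1 (2^-1).
rewrite ger0_norm ?invr_ge0// invf_lt1// ltr1n => /(_ isT).
by apply: cvg_trans; apply: near_eq_cvg; near=> k; rewrite /geometric /= mul1r exprVn.
Unshelve. all: by end_near.
Qed.

Lemma esum_ge_seq (R : realType) (I : choiceType) (A : set I) (f : I -> R) s :
  uniq s -> (forall x, x \in s -> A x) ->
  ((\sum_(x <- s) f x)%:E <= \esum_(x in A) (f x)%:E)%E.
Proof.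
move=> us sA; apply: esum_ge; exists [set` s].
  by split; [exact: finite_seq|].
by rewrite -fsbig_seq// sumEFin.
Qed.

Lemma esum_le_seq (R : realType) (I : choiceType) (A : set I) (f : I -> R) M :
  (forall s, uniq s -> (forall x, x \in s -> A x) -> ((\sum_(x <- s) f x)%:E <= M)%E) ->
  (\esum_(x in A) (f x)%:E <= M)%E.
Proof.
move=> h; apply: ge_ereal_sup => _ [X [fX XA] <-].
have /finite_seqP[s Xs] := fX.
have -> : X = [set` undup s] by rewrite Xs; apply/seteqP; split=> x /=; rewrite mem_undup.
rewrite -fsbig_seq ?undup_uniq// sumEFin; apply: h (undup_uniq _) _ => x.
by rewrite mem_undup => xs; apply: XA; rewrite Xs.
Qed.

Lemma esum_approx_seq (R : realType) (I : choiceType) (A : set I) (f : I -> R) S e :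
  \esum_(x in A) (f x)%:E = S%:E -> 0 < e ->
  exists s, [/\ uniq s, (forall x, x \in s -> A x) & S - e < \sum_(x <- s) f x].
Proof.
move=> hS e0; apply: contrapT => H.
have : (\esum_(x in A) (f x)%:E <= (S - e)%:E)%E.
  apply: esum_le_seq => s us sA; rewrite lee_fin leNgt; apply/negP => lt.
  by apply: H; exists s.
by rewrite hS lee_fin; lra.
Qed.

Definition dyadic_sum (R : realType) (f D : R -> R) (k : nat) : R :=
  \sum_(j < (2 ^ k)%N) f (D (j.+1%:R / 2 ^+ k) - D (j%:R / 2 ^+ k)).

Lemma dyadic_cell (R : realType) (x : R) k : 0 < x -> x <= 1 ->
  exists2 j, (j < 2 ^ k)%N & j%:R / 2 ^+ k < x <= j.+1%:R / 2 ^+ k.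
Proof.
move=> x0 x1; have n0 := exp2n_gt0 R k.
have ex : exists j, x <= j.+1%:R / 2 ^+ k.
  exists (2 ^ k).-1%N; rewrite prednK ?expn_gt0// natrX divff ?x1//.
case: (ex_minnP ex) => j xj jmin; exists j.
  rewrite -(prednK (expn_gt0 2 k)) ltnS; apply: jmin.
  by rewrite prednK ?expn_gt0// natrX divff// gt_eqF.
rewrite xj andbT; case: j xj jmin => [|j] xj jmin; first by rewrite mul0r.
by rewrite ltNge; apply/negP => /jmin; rewrite ltnn.
Qed.

(** The path truncated to the finitely many jump times in [s], the drift being kept in full. *)
Definition drift_jumps (R : realType) (al : R) (Delta : R -> R) (s : seq R) (t : R) :=
  al * t + \sum_(x <- s) (x <= t)%R%:R * Delta x.

(** The cells shrink to [x]: the drift contributes [al / 2^k], and each of the finitely many jump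
    times, being different from [x], eventually lies outside the cell. *)
Lemma cvg_drift_jumps_cell (R : realType) (al : R) (Delta : R -> R) (s : seq R)
    (x : R) (u v : nat -> R) :
  x \notin s -> (forall k, u k < x <= v k) -> (forall k, v k - u k = (2 ^+ k)^-1) ->
  drift_jumps al Delta s (v k) - drift_jumps al Delta s (u k) @[k --> \oo] --> 0.
Proof.
move=> xs uxv vu.
(* The dummy value 0 at [y = x] is harmless because [x] is not in [s]; it makes every term converge
   to 0, as [cvg_big_sum] asks for all indices and not only for those in [s]. *)
have -> : (fun k => drift_jumps al Delta s (v k) - drift_jumps al Delta s (u k)) =
  (fun k => al * (2 ^+ k)^-1 +
     \sum_(y <- s) (if y == x then 0 else ((y <= v k)%R%:R - (y <= u k)%R%:R) * Delta y)).
  apply/funext => k; rewrite -vu /drift_jumps.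
  have -> : \sum_(y <- s) (if y == x then 0 else ((y <= v k)%R%:R - (y <= u k)%R%:R) * Delta y)
     = \sum_(y <- s) ((y <= v k)%R%:R * Delta y - (y <= u k)%R%:R * Delta y).
    rewrite big_seq [RHS]big_seq; apply: eq_bigr => y ys.
    rewrite ifF ?mulrBl//; apply/negbTE; apply: contra xs => /eqP <-//.
  rewrite sumrB; ring.
rewrite [X in _ --> X](_ : 0 = al * 0 + \sum_(y <- s) 0); last first.
  by rewrite mulr0 big1_eq add0r.
apply: cvgD; first by apply: cvgM; [exact: cvg_cst|exact: cvg_inv_exp2].
apply: (@cvg_big_sum R R s nat \oo _ (fun y k => if y == x then 0 else ((y <= v k)%R%:R - (y <= u k)%R%:R) * Delta y) (fun=> 0)) => y; case: eqVneq => [|yx]; first by move=> _; exact: cvg_cst.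
apply: cvg_near_cst; near=> k.
have : (2 ^+ k)^-1 < `|x - y|.
  near: k; apply: (cvgr_lt _ (@cvg_inv_exp2 R)).
  by rewrite normr_gt0 subr_eq0 eq_sym.
have := vu k; have /andP[] := uxv k.
case: (ltrP y x) => [yx'|xy].
  move=> ux xv vuk lt.
  have -> : y <= v k by lra.
  have -> : y <= u k by lra.
  by rewrite subrr mul0r.
move=> ux xv vuk lt.
rewrite !leNgt.
have -> : v k < y by lra.
have -> : u k < y by lra.
by rewrite subrr mul0r.
Unshelve. all: by end_near.
Qed.

Lemma drift_jumps_cons (R : realType) (al : R) (Delta : R -> R) x (s : seq R) t :
  drift_jumps al Delta (x :: s) t = drift_jumps al Delta s t + (x <= t)%R%:R * Delta x.
Proof. by rewrite /drift_jumps big_cons addrCA addrC. Qed.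

Lemma drift_jumps_incr_ge0 (R : realType) (al : R) (Delta : R -> R) (s : seq R) u v :
  0 <= al -> (forall x, x \in s -> 0 <= Delta x) -> u <= v ->
  0 <= drift_jumps al Delta s v - drift_jumps al Delta s u.
Proof.
move=> al0 Delta0 uv; rewrite subr_ge0 /drift_jumps lerD ?ler_wpM2l//.
rewrite big_seq [leRHS]big_seq; apply: ler_sum => x xs.
rewrite ler_wpM2r ?Delta0// ler_nat.
by case: (leP x u) => // xu; rewrite (le_trans xu uv).
Qed.

Lemma dyadic_step_ge0 (R : realType) k (j : nat) :
  j%:R / 2 ^+ k <= j.+1%:R / 2 ^+ k :> R.
Proof. by rewrite ler_wpM2r ?invr_ge0 ?ler_nat// exprn_ge0. Qed.

(* A new jump only changes the summand of the cell that contains it, where the other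
   increments vanish in the limit. *)
Lemma cvg_dyadic_sum_drift_jumps (R : realType) (f : R -> R) (K b al : R)
    (Delta : R -> R) (s : seq R) :
  0 <= K -> 0 <= al -> f 0 = 0 ->
  (forall x y, 0 <= x -> 0 <= y -> `|f x - f y| <= K * `|x - y|) ->
  2 ^+ k * f (al / 2 ^+ k) @[k --> \oo] --> b ->
  uniq s -> (forall x, x \in s -> [/\ 0 < x, x <= 1 & 0 <= Delta x]) ->
  dyadic_sum f (drift_jumps al Delta s) k @[k --> \oo] --> b + \sum_(x <- s) f (Delta x).
Proof.
move=> K0 al0 f0 fK fal; elim: s => [|x s IH] /= => [_ _|/andP[xs us] hs].
  rewrite big_nil addr0; rewrite [X in X @ _](_ : _ = fun k => 2 ^+ k * f (al / 2 ^+ k)) //.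
  apply/funext => k; rewrite /dyadic_sum.
  under eq_bigr => j _.
    have -> : drift_jumps al Delta [::] (j.+1%:R / 2 ^+ k) -
              drift_jumps al Delta [::] (j%:R / 2 ^+ k) = al / 2 ^+ k.
      by rewrite /drift_jumps !big_nil !addr0 -natr1; ring.
    over.
  by rewrite sumr_const card_ord -natrX mulr_natl.
have [x0 x1 Dx0] := hs x (mem_head _ _).
have hs' y : y \in s -> [/\ 0 < y, y <= 1 & 0 <= Delta y].
  by move=> ys; apply: hs; rewrite inE ys orbT.
have {}IH := IH us hs'.
have /choice[j hj] : forall k, exists j, (j < 2 ^ k)%N /\
    j%:R / 2 ^+ k < x <= j.+1%:R / 2 ^+ k.
  by move=> k; have [j ? ?] := dyadic_cell k x0 x1; exists j.
pose z k := drift_jumps al Delta s ((j k).+1%:R / 2 ^+ k) -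
            drift_jumps al Delta s ((j k)%:R / 2 ^+ k).
have z0 k : 0 <= z k.
  apply: drift_jumps_incr_ge0 => //; last exact: dyadic_step_ge0.
  by move=> y /hs'[].
have zcvg : z k @[k --> \oo] --> 0.
  apply: (@cvg_drift_jumps_cell _ _ _ _ x _ _ xs) => [k|k]; first by case: (hj k).
  by rewrite -mulrBl -natr1 addrAC subrr add0r mul1r.
rewrite [X in X @ _](_ : _ = fun k => dyadic_sum f (drift_jumps al Delta s) k +
    (f (z k + Delta x) - f (z k))); last first.
  apply/funext => k; rewrite /dyadic_sum; have [jk /andP[ux xv]] := hj k.
  rewrite (bigD1 (Ordinal jk))//= [in RHS](bigD1 (Ordinal jk))//=.
  have -> : drift_jumps al Delta (x :: s) ((j k).+1%:R / 2 ^+ k) -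
            drift_jumps al Delta (x :: s) ((j k)%:R / 2 ^+ k) = z k + Delta x.
    by rewrite !drift_jumps_cons xv leNgt ux /z mul1r mul0r; ring.
  rewrite -/(z k); set S1 := \sum_(i < _ | _) _; set S2 := \sum_(i < _ | _) _.
  suff -> : S1 = S2 by ring.
  apply: eq_bigr => i /eqP ij; congr f; rewrite !drift_jumps_cons.
  have -> : x <= i.+1%:R / 2 ^+ k = (x <= i%:R / 2 ^+ k) :> bool.
    have [lt|gt|e] := ltngtP i (j k); last by case: ij; apply/val_inj.
      have le : i.+1%:R / 2 ^+ k <= (j k)%:R / 2 ^+ k :> R.
        by rewrite ler_wpM2r ?invr_ge0 ?exprn_ge0// ler_nat.
      have := dyadic_step_ge0 R k i => le'.
      by rewrite !leNgt (le_lt_trans le ux) (le_lt_trans le' (le_lt_trans le ux)).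
    have le : (j k).+1%:R / 2 ^+ k <= i%:R / 2 ^+ k :> R.
      by rewrite ler_wpM2r ?invr_ge0 ?exprn_ge0// ler_nat.
    by rewrite (le_trans xv le) (le_trans (le_trans xv le) (dyadic_step_ge0 _ _ _)).
  ring.
rewrite big_cons addrCA addrC; apply: cvgD => //.
apply/cvgrPdist_le => e e0; near=> k.
(* Both [f (z k + Delta x) - f (Delta x)] and [f (z k)] are at most [K * z k] in absolute value; the
   extra 1 keeps the divisor positive when [K = 0]. *)
have zk : (2 * K + 1) * z k <= e.
  rewrite mulrC -ler_pdivlMr; last by lra.
  near: k; apply: (cvgr_le _ zcvg); rewrite divr_gt0//; lra.
have h1 := fK (Delta x) (z k + Delta x) Dx0 (addr_ge0 (z0 k) Dx0).
have h2 := fK 0 (z k) (lexx _) (z0 k).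
rewrite opprD addrA opprK.
apply: (le_trans (ler_normD _ _)).
have zk0 := z0 k; have Kz : 0 <= K * z k by rewrite mulr_ge0.
move: h1 h2; rewrite f0 opprD addrCA subrr addr0 !sub0r !normrN (ger0_norm zk0).
by nra.
Unshelve. all: by end_near.
Qed.

(** A finite family of jump times in []0, u]] and the times of [s] in []u, v]] together form a
    finite family in []0, v]], so their sum is at most the jump part of [D v]; the supremum over the
    first family gives the claim. Hence the discarded part of the path has nonnegative
    increments. *)
Lemma drift_jumps_incr_le (R : realType) (al : R) (Delta D : R -> R) (s : seq R) u v :
  (forall t, 0 <= t <= 1 ->
    (D t)%:E = ((al * t)%:E + \esum_(x in `]0%R, t]%classic) (Delta x)%:E)%E) ->
  uniq s -> (forall x, x \in s -> 0 < x <= 1) ->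
  0 <= u -> u <= v -> v <= 1 ->
  drift_jumps al Delta s v - drift_jumps al Delta s u <= D v - D u.
Proof.
move=> hD us hs u0 uv v1.
have tot t : 0 <= t <= 1 -> \esum_(x in `]0%R, t]%classic) (Delta x)%:E = (D t - al * t)%:E.
  move=> /hD; case: (\esum_(x in _) _) => //= S [->]; congr EFin; ring.
have split : drift_jumps al Delta s v - drift_jumps al Delta s u =
    al * v - al * u + \sum_(x <- [seq x <- s | u < x <= v]) Delta x.
  rewrite /drift_jumps big_filter.
  have -> : \sum_(x <- s | u < x <= v) Delta x =
      \sum_(x <- s) (x <= v)%R%:R * Delta x - \sum_(x <- s) (x <= u)%R%:R * Delta x.
    rewrite -sumrB [LHS]big_mkcond; apply: eq_bigr => x _.
    case: (lerP x u) => xu /=; last by case: ifP => _; rewrite mul0r subr0 ?mul1r ?mul0r.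
    by rewrite (le_trans xu uv) subrr.
  ring.
have : (\esum_(x in `]0%R, u]%classic) (Delta x)%:E <=
   (D v - al * v - \sum_(x <- [seq x <- s | u < x <= v]) Delta x)%:E)%E.
  apply: esum_le_seq => s' us' hs'; rewrite lee_fin lerBrDr -big_cat -lee_fin -tot ?v1 ?(le_trans u0 uv)//.
  apply: esum_ge_seq.
    rewrite cat_uniq us' filter_uniq// andbT; apply/hasPn => x.
    rewrite mem_filter => /andP[/andP[ux _] _]; apply/negP => /hs'.
    by rewrite /= in_itv/= leNgt ux andbF.
  move=> x; rewrite mem_cat mem_filter /= in_itv/= => /orP[/hs'|/andP[/andP[_ ->] /hs/andP[->]]//].
  by rewrite /= in_itv/= => /andP[-> xu]; rewrite (le_trans xu uv).
rewrite split tot ?u0 ?(le_trans uv v1)// lee_fin; lra.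
Qed.

Lemma drift_jumps0 (R : realType) (al : R) (Delta : R -> R) (s : seq R) :
  (forall x, x \in s -> 0 < x <= 1) -> drift_jumps al Delta s 0 = 0.
Proof.
move=> hs; rewrite /drift_jumps mulr0 add0r big_seq big1// => x /hs/andP[x0 _].
by rewrite leNgt x0 mul0r.
Qed.

Lemma drift_jumps1 (R : realType) (al : R) (Delta : R -> R) (s : seq R) :
  (forall x, x \in s -> 0 < x <= 1) ->
  drift_jumps al Delta s 1 = al + \sum_(x <- s) Delta x.
Proof.
move=> hs; rewrite /drift_jumps mulr1; congr (_ + _).
by rewrite big_seq [RHS]big_seq; apply: eq_bigr => x /hs/andP[_ ->]; rewrite mul1r.
Qed.

Lemma dyadic_grid_le1 (R : realType) k (j : 'I_(2 ^ k)) : j.+1%:R / 2 ^+ k <= 1 :> R.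
Proof. by rewrite ler_pdivrMr ?exp2n_gt0// mul1r -natrX ler_nat ltn_ord. Qed.

(* All but finitely many jumps are discarded: as [f] is Lipschitz, this costs at most [K]
   times their total size, uniformly in [k]. *)
Lemma cvg_dyadic_sum (R : realType) (f : R -> R) (K b al : R) (Delta D : R -> R) :
  0 <= K -> 0 <= al -> f 0 = 0 -> (forall x, 0 <= x -> 0 <= f x) ->
  (forall x y, 0 <= x -> 0 <= y -> `|f x - f y| <= K * `|x - y|) ->
  2 ^+ k * f (al / 2 ^+ k) @[k --> \oo] --> b ->
  (forall x, 0 < x <= 1 -> 0 <= Delta x) ->
  (forall t, 0 <= t <= 1 ->
    (D t)%:E = ((al * t)%:E + \esum_(x in `]0%R, t]%classic) (Delta x)%:E)%E) ->
  exists S, \esum_(x in `]0%R, 1%R]%classic) (f (Delta x))%:E = S%:E /\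
    dyadic_sum f D k @[k --> \oo] --> b + S.
Proof.
move=> K0 al0 f0 fge0 fK fal D0 hD.
have tot : \esum_(x in `]0%R, 1%R]%classic) (Delta x)%:E = (D 1 - al)%:E.
  have : 0 <= (1 : R) <= 1 by rewrite ler01 lexx.
  by move=> /(hD 1); rewrite mulr1; case: (\esum_(x in _) _) => //= S [->]; congr EFin; ring.
have fle x : 0 <= x -> f x <= K * x.
  by move=> x0; have := fK x 0 x0 (lexx _); rewrite f0 !subr0 !ger0_norm ?fge0.
have inI (s : seq R) : (forall x, x \in s -> (`]0, 1]%classic : set R) x) ->
    forall x, x \in s -> 0 < x <= 1.
  by move=> h x /h; rewrite /= ?in_itv.
have sum_le s : uniq s -> (forall x, x \in s -> 0 < x <= 1) ->
    \sum_(x <- s) Delta x <= D 1 - al.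
  move=> us hs; rewrite -lee_fin -tot; exact: esum_ge_seq.
have fsum_le s : (forall x, x \in s -> 0 < x <= 1) ->
    \sum_(x <- s) f (Delta x) <= K * \sum_(x <- s) Delta x.
  by move=> hs; rewrite mulr_sumr big_seq [leRHS]big_seq; apply: ler_sum => x /hs/D0/fle.
have [S hS] : exists S, \esum_(x in `]0%R, 1%R]%classic) (f (Delta x))%:E = S%:E.
  have : (\esum_(x in `]0%R, 1%R]%classic) (f (Delta x))%:E <= (K * (D 1 - al))%:E)%E.
    apply: esum_le_seq => s us hs; rewrite lee_fin; apply: (le_trans (fsum_le _ (inI _ hs))).
    by rewrite ler_wpM2l// sum_le//; exact: inI.
  have : (0 <= \esum_(x in `]0%R, 1%R]%classic) (f (Delta x))%:E)%E.
    by apply: esum_ge0 => x; rewrite /= in_itv/= => hx; rewrite lee_fin fge0 ?D0.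
  by case: (\esum_(x in _) _) => // S _ _; exists S.
exists S; split=> //.
apply/cvgrPdist_le => e e0.
(* Error budget: [e'] for the truncated path, [K * e'] for the jumps missing in the dyadic sum and
   [K * e'] for those missing in [S]. *)
pose e' := e / (2 * K + 1).
have e'0 : 0 < e' by rewrite divr_gt0//; lra.
have [s [us /inI hs ltS]] := esum_approx_seq tot e'0.
have hs' x : x \in s -> [/\ 0 < x, x <= 1 & 0 <= Delta x].
  by move=> /hs /[dup] /D0 ? /andP[].
have := cvg_dyadic_sum_drift_jumps K0 al0 f0 fK fal us hs'.
move=> /cvgrPdist_le /(_ e' e'0) near_s.
have S_lb : \sum_(x <- s) f (Delta x) <= S.
  rewrite -lee_fin -hS; exact: esum_ge_seq.
have S_ub : S <= \sum_(x <- s) f (Delta x) + K * e'.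
  rewrite -lee_fin -hS; apply: esum_le_seq => s' us' /inI hs''; rewrite lee_fin.
  pose s2 := [seq x <- s' | x \notin s].
  have hs2 x : x \in s2 -> 0 < x <= 1 by rewrite mem_filter => /andP[_ /hs''].
  have le1 : \sum_(x <- s') f (Delta x) <= \sum_(x <- s) f (Delta x) + \sum_(x <- s2) f (Delta x).
    rewrite (bigID (mem s)) /= -[X in _ + X]big_filter lerD2r.
    rewrite [leRHS](bigID (mem s')) /= -[leLHS]big_filter -[X in _ <= X + _]big_filter.
    rewrite (perm_big [seq x <- s | x \in s']).
      rewrite lerDl big_seq_cond; apply: sumr_ge0 => x /andP[/hs/D0 Dx _]; exact: fge0.
    apply: uniq_perm; rewrite ?filter_uniq// => x.
    by rewrite !mem_filter andbC.
  have le2 : \sum_(x <- s) Delta x + \sum_(x <- s2) Delta x <= D 1 - al.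
    rewrite -big_cat; apply: sum_le.
      rewrite cat_uniq us filter_uniq// andbT; apply/hasPn => x.
      by rewrite mem_filter => /andP[].
    by move=> x; rewrite mem_cat => /orP[/hs|/hs2].
  have le3 := fsum_le _ hs2.
  have : K * \sum_(x <- s2) Delta x <= K * e' by rewrite ler_wpM2l//; lra.
  lra.
near=> k.
have dist : `|dyadic_sum f D k - dyadic_sum f (drift_jumps al Delta s) k| <= K * e'.
  rewrite /dyadic_sum -sumrB.
  (* [Q] is the discarded part of the path. Its increments bound, up to the factor [K], the change
     of each summand; they telescope to the total size of the jumps outside [s], which is less than
     [e']. *)
  pose Q t := D t - drift_jumps al Delta s t.
  have : \sum_(j < (2 ^ k)%N) K * (Q (j.+1%:R / 2 ^+ k) - Q (j%:R / 2 ^+ k)) <= K * e'.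
    rewrite -mulr_sumr ler_wpM2l// -(big_mkord xpredT
       (fun j : nat => Q (j.+1%:R / 2 ^+ k) - Q (j%:R / 2 ^+ k))).
    rewrite telescope_sumr// natrX divff ?gt_eqF ?exp2n_gt0// mul0r /Q.
    rewrite drift_jumps0// drift_jumps1//.
    have : (D 0)%:E = 0.
      by rewrite hD ?lexx ?ler01// mulr0 add0e set_itvoc0 esum_set0.
    by case=> ->; lra.
  apply: le_trans; apply: (le_trans (ler_norm_sum _ _ _)).
  apply: ler_sum => j _.
  have uv := dyadic_step_ge0 R k j.
  have u0 : 0 <= j%:R / 2 ^+ k :> R by rewrite divr_ge0// exprn_ge0.
  have le := drift_jumps_incr_le hD us hs u0 uv (dyadic_grid_le1 _ _).
  have ge : 0 <= drift_jumps al Delta s (j.+1%:R / 2 ^+ k) - drift_jumps al Delta s (j%:R / 2 ^+ k).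
    by apply: drift_jumps_incr_ge0 => // x /hs'[].
  apply: (le_trans (fK _ _ (le_trans ge le) ge)).
  by rewrite ler_wpM2l// ger0_norm /Q; lra.
have nk : `|b + \sum_(x <- s) f (Delta x) - dyadic_sum f (drift_jumps al Delta s) k| <= e'.
  by near: k.
have ee : e = 2 * (K * e') + e' by rewrite /e'; field; lra.
move: nk dist; rewrite !ler_norml ee => /andP[a1 a2] /andP[a3 a4].
by apply/andP; split; lra.
Unshelve. all: by end_near.
Qed.

(** * Sums over jumps and the jump measure *)

(** Monotone convergence for sums over an arbitrary index set: finite partial sums pass to the
    limit, and the suprema over [n] and over finite families commute. *)
Lemma cvg_esum_nondecreasing (R : realType) (I : choiceType) (A : set I)
    (f : nat -> I -> R) (g : I -> R) :
  (forall x, A x -> {homo f^~ x : n m / (n <= m)%N >-> n <= m}) ->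
  (forall x, A x -> f n x @[n --> \oo] --> g x) ->
  (\esum_(x in A) (f n x)%:E @[n --> \oo] --> \esum_(x in A) (g x)%:E)%E.
Proof.
move=> nd fg.
have le n x : A x -> f n x <= g x.
  move=> Ax; rewrite -(cvg_lim _ (fg _ Ax))//; apply: nondecreasing_cvgn_le.
    exact: nd.
  by apply/cvg_ex; exists (g x); exact: fg.
have -> : \esum_(x in A) (g x)%:E =
    ereal_sup (range (fun n => \esum_(x in A) (f n x)%:E)).
  apply/eqP; rewrite eq_le; apply/andP; split; last first.
    apply: ge_ereal_sup => _ [n _ <-]; apply: le_esum => x Ax.
    by rewrite lee_fin le.
  apply: esum_le_seq => s us hs.
  have cv : (\sum_(x <- s) f n x)%:E @[n --> \oo] --> (\sum_(x <- s) g x)%:E.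
    apply/cvg_EFin; first exact: nearW.
    rewrite [X in X @ _](_ : _ = fun n => \sum_(x <- s) (if x \in s then f n x else 0)); last first.
      by apply/funext => n /=; rewrite big_seq [RHS]big_seq; apply: eq_bigr => x ->.
    have -> : \sum_(x <- s) g x = \sum_(x <- s) (if x \in s then g x else 0).
      by rewrite big_seq [RHS]big_seq; apply: eq_bigr => x ->.
    apply: (@cvg_big_sum _ _ _ _ _ _ (fun x n => if x \in s then f n x else 0)) => x.
    by case: ifPn => [/hs/fg//|_]; exact: cvg_cst.
  rewrite -(cvg_lim _ cv)//; apply: lime_le.
    by apply/cvg_ex; eexists; exact: cv.
  apply: nearW => n; apply: (@le_trans _ _ (\esum_(x in A) (f n x)%:E)).
    exact: esum_ge_seq.
  by apply: ereal_sup_ubound; exists n.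
apply: ereal_nondecreasing_cvgn => n m nm; apply: le_esum => x Ax.
by rewrite lee_fin nd.
Qed.

(** Turns the numbers of jumps in [is_jump_measure] into sums over jump times, to which the limit
    arguments apply. On an infinite set [counting] is infinite, and finite subsets of arbitrary size
    push the sum above every bound. *)
Lemma esum_indic_counting (R : realType) (I : choiceType) (A : set I) (p : I -> bool) :
  \esum_(x in A) ((p x)%:R%:E : \bar R) = counting [set x | A x /\ p x].
Proof.
rewrite /counting; case: asboolP => [/[dup] fS|/infinite_set_fsetP iS].
  move=> /finite_seqP [s' Ss'].
  set S := [set x | _ ] in Ss' fS *.
  have -> : \esum_(x in A) ((p x)%:R%:E : \bar R) = \esum_(x in S) 1%E.
    rewrite esum_mkcond [RHS]esum_mkcond; apply: eq_esum => x _.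
    rewrite /S; case: ifPn => xA; case: ifPn => xS //.
      by move: xS; rewrite inE /= => -[_ ->].
      move: xS; rewrite notin_setE /=; case: (p x) => // ns.
      by exfalso; apply: ns; split => //; exact/set_mem.
    by move: xS; rewrite inE /= => -[/mem_set]; rewrite (negbTE xA).
  rewrite esum_fset// -[X in X = _]/(\sum_(i \in S) (1%:E : \bar R)).
  rewrite fsbig_finite//= sumEFin.
  by rewrite big_const_seq count_predT iter_addr_0 .
apply/eqP; rewrite eq_le leey /=.
rewrite leye_eq; apply/eqP/eqyP => M M0.
have [F FS Fn] := iS (Num.Def.truncn M).+1.
apply: (@le_trans _ _ (\sum_(x <- finmap.enum_fset F) (p x)%:R)%:E); last first.
  apply: esum_ge_seq; first exact: finmap.fset_uniq.
  by move=> x xF; have [] := FS x xF.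
rewrite lee_fin.
have -> : \sum_(x <- finmap.enum_fset F) ((p x)%:R : R) = (size (finmap.enum_fset F))%:R.
  rewrite -sum1_size natr_sum big_seq [RHS]big_seq; apply: eq_bigr => x xF.
  by have [_ ->] := FS x xF.
apply: (@le_trans _ _ (Num.Def.truncn M).+1%:R); last by rewrite ler_nat.
by apply: ltW; apply: Num.Theory.truncnS_gt.
Qed.

(** A discrete layer-cake formula for [y] in [[0, 1]]. The levels start at [1 / 2^n] and not at 0,
    because the numbers of jumps are handled only above positive levels. *)
Definition step_approx (R : realType) (n : nat) (y : R) : R :=
  \sum_(j < (2 ^ n)%N) 2^- n * (j.+1%:R / 2 ^+ n < y)%R%:R.

Lemma step_approx_ge0 (R : realType) n (y : R) : 0 <= step_approx n y.
Proof. by apply: sumr_ge0 => j _; rewrite mulr_ge0 ?invr_ge0 ?exprn_ge0. Qed.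

(** Each old level is replaced by two levels of half the weight, one equal to it and one below it;
    both are passed whenever the old one is. *)
Lemma step_approx_nd (R : realType) (y : R) :
  {homo (fun n => step_approx n y) : n m / (n <= m)%N >-> n <= m}.
Proof.
apply/nondecreasing_seqP => n; rewrite /step_approx expnS mul2n.
rewrite (big_double (fun j : nat => 2 ^- n.+1 * (j.+1%:R / 2 ^+ n.+1 < y)%R%:R)).
apply: ler_sum => j _.
have e1 : 2 ^- n = 2 ^- n.+1 + 2 ^- n.+1 :> R.
  by rewrite exprS; field; rewrite gt_eqF ?exp2n_gt0.
have e2 : (j.*2.+2)%:R / 2 ^+ n.+1 = j.+1%:R / 2 ^+ n :> R.
  by rewrite -doubleS -mul2n natrM exprS; field; rewrite gt_eqF ?exp2n_gt0.
have := dyadic_step_ge0 R n.+1 j.*2.+1; rewrite e2 => le.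
case: (ltP (j.+1%:R / 2 ^+ n) y) => ny; last first.
  by rewrite !mulr0 addr0 mulr_ge0// invr_ge0 exprn_ge0.
by rewrite (le_lt_trans le ny) !mulr1 -e1.
Qed.

(** The last alternative reflects the cap at [N]: without it the count of positive integers below
    [y] is at least [y - 1]. *)
Lemma count_lt_bounds (R : realType) (y : R) N : 0 <= y ->
  let S := \sum_(j < N) ((j.+1%:R < y)%R%:R : R) in
  [/\ S <= y, S <= N%:R & y - 1 <= S \/ N%:R <= S].
Proof.
move=> y0 /=; elim: N => [|N [IH1 IH2 IH3]]; first by rewrite big_ord0; split=> //; right.
rewrite big_ord_recr /=; case: ltP => [lt|ge].
  move: lt IH2 IH3; rewrite -!natr1 => lt IH2 IH3; split; [lra|lra|right; case: IH3; lra].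
rewrite addr0; split => //; first by rewrite (le_trans IH2)// ler_nat.
left; case: IH3 => // IH3; move: ge; rewrite -natr1; lra.
Qed.

Lemma step_approx_bounds (R : realType) n (y : R) : 0 <= y <= 1 ->
  y - 2 ^- n <= step_approx n y <= y.
Proof.
move=> /andP[y0 y1]; have n0 := exp2n_gt0 R n.
have -> : step_approx n y = 2 ^- n * \sum_(j < (2 ^ n)%N) ((j.+1%:R < y * 2 ^+ n)%R%:R : R).
  rewrite mulr_sumr; apply: eq_bigr => j _; by rewrite ltr_pdivrMr.
have [h1 h2 h3] := @count_lt_bounds R (y * 2 ^+ n) (2 ^ n)%N (mulr_ge0 y0 (ltW n0)).
rewrite mulrC ler_pdivrMr// h1 andbT.
rewrite ler_pdivlMr// mulrBl mulVf ?gt_eqF//; case: h3 => //.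
rewrite natrX; apply: le_trans; rewrite lerBlDr (le_trans (y := 2 ^+ n))//.
  by rewrite ler_piMl// ltW.
by rewrite lerDl.
Qed.

Lemma cvg_step_approx (R : realType) (y : R) : 0 <= y <= 1 ->
  step_approx n y @[n --> \oo] --> y.
Proof.
move=> y01; apply: (@squeeze_cvgr _ _ _ _ (fun n => y - 2 ^- n) (cst y)).
- by apply: nearW => n; exact: step_approx_bounds.
- rewrite -[X in _ --> X]subr0; apply: cvgB; [exact: cvg_cst|exact: cvg_inv_exp2].
- exact: cvg_cst.
Qed.

(** Applied to the opposite of an increment or of a jump of [L i], so that its argument is
    nonnegative. *)
Definition exp_loss (R : realType) (x : R) : R := 1 - expR (- x).

Lemma exp_loss0 (R : realType) : exp_loss 0 = 0 :> R.
Proof. by rewrite /exp_loss oppr0 expR0 subrr. Qed.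

(** The quadratic bound comes from [(1 - x + x^2) (1 + x) = 1 + x^3 >= 1] and [1 + x <= expR x]. It
    is the source of the second order errors of the time discretisation. *)
Lemma exp_loss_bounds (R : realType) (x : R) : 0 <= x ->
  [/\ 0 <= exp_loss x, exp_loss x <= 1, exp_loss x <= x & x - x ^+ 2 <= exp_loss x].
Proof.
move=> x0; rewrite /exp_loss; have e0 := expR_gt0 (- x).
have e1 := expR_ge1Dx (- x); have e2 := expR_ge1Dx x.
have e3 : expR (- x) * expR x = 1 by rewrite -expRD addNr expR0.
have e4 : expR (- x) <= 1 by rewrite -expR0 ler_expR oppr_le0.
split; [lra|lra|lra|].
suff : expR (- x) <= 1 - x + x ^+ 2 by lra.
rewrite -(ler_pM2r (expR_gt0 x)) e3.
apply: (@le_trans _ _ ((1 - x + x ^+ 2) * (1 + x))).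
  have -> : (1 - x + x ^+ 2) * (1 + x) = 1 + x ^+ 3 by ring.
  by rewrite lerDl exprn_ge0.
by rewrite ler_wpM2l//; nra.
Qed.

Lemma exp_loss_homo (R : realType) (x y : R) : x <= y -> exp_loss x <= exp_loss y.
Proof. by move=> xy; rewrite /exp_loss lerB// ler_expR lerN2. Qed.

Lemma exp_loss_lip (R : realType) (x y : R) : 0 <= x -> 0 <= y ->
  `|exp_loss x - exp_loss y| <= 1 * `|x - y|.
Proof.
wlog xy : x y / x <= y => [H x0 y0|x0 y0].
  case/orP: (le_total x y) => xy; first exact: H.
  by rewrite distrC (distrC x); apply: H.
rewrite mul1r distrC ger0_norm ?subr_ge0 ?exp_loss_homo// distrC ger0_norm ?subr_ge0//.
have -> : exp_loss y - exp_loss x = expR (- x) * exp_loss (y - x).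
  by rewrite /exp_loss mulrBr -expRD; have -> : - x + - (y - x) = - y; [ring|ring].
have yx : 0 <= y - x by rewrite subr_ge0.
have [h0 h1 h2 _] := exp_loss_bounds yx.
apply: le_trans h2; rewrite ler_piMl// -expR0 ler_expR oppr_le0//.
Qed.

(** The defect of additivity is exactly the product [exp_loss x * exp_loss y]. *)
Lemma exp_loss_subadd (R : realType) (x y : R) : 0 <= x -> 0 <= y ->
  exp_loss (x + y) <= exp_loss x + exp_loss y.
Proof.
move=> /exp_loss_bounds[x0 _ _ _] /exp_loss_bounds[y0 _ _ _].
have -> : exp_loss (x + y) = exp_loss x + exp_loss y - exp_loss x * exp_loss y.
  by rewrite /exp_loss opprD expRD; ring.
by rewrite gerBl mulr_ge0.
Qed.

(** The derivative of [exp_loss] at 0 is 1, so the drift enters the limit of the dyadic sums as [al]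
    itself; for the ramps below this contribution is 0. *)
Lemma cvg_exp_loss_dyadic (R : realType) (al : R) : 0 <= al ->
  2 ^+ k * exp_loss (al / 2 ^+ k) @[k --> \oo] --> al.
Proof.
move=> al0.
apply: (@squeeze_cvgr _ _ _ _ (fun k => al - al ^+ 2 * 2 ^- k) (cst al)).
- apply: nearW => k; have n0 := exp2n_gt0 R k.
  have [_ _ h1 h2] := exp_loss_bounds (divr_ge0 al0 (ltW n0)).
  have ne : 2 ^+ k != 0 :> R by rewrite gt_eqF.
  apply/andP; split.
    have -> : al - al ^+ 2 / 2 ^+ k = 2 ^+ k * (al / 2 ^+ k - (al / 2 ^+ k) ^+ 2) by field.
    by rewrite ler_wpM2l// ltW.
  by rewrite mulrC -ler_pdivlMr.
- rewrite -[X in _ --> X]subr0 -(mulr0 (al ^+ 2)).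
  by apply: cvgB; [exact: cvg_cst|apply: cvgM; [exact: cvg_cst|exact: cvg_inv_exp2]].
- exact: cvg_cst.
Qed.

Lemma measurable_exp_loss (R : realType) : measurable_fun [set: R] (@exp_loss R).
Proof.
apply: measurable_funB => //; apply: measurableT_comp => //.
Qed.

(* Lipschitz functions vanishing near 0 that increase to the indicator of
   [v < exp_loss x]. *)
Definition ramp (R : realType) (v : R) (n : nat) (x : R) : R :=
  Num.min 1 (n%:R * Num.max 0 (exp_loss x - v)).

Lemma ramp_ge0 (R : realType) (v : R) n x : 0 <= ramp v n x.
Proof. by rewrite le_min ler01 mulr_ge0// le_max lexx. Qed.

Lemma ramp_eq0 (R : realType) (v : R) n x : exp_loss x <= v -> ramp v n x = 0.
Proof.
by move=> xv; rewrite /ramp; have -> : Num.max 0 (exp_loss x - v) = 0;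
  [apply/max_idPl; rewrite subr_le0|rewrite mulr0; apply/min_idPr].
Qed.

Lemma max_lip (R : realType) (c p q : R) :
  `|Num.max c p - Num.max c q| <= `|p - q|.
Proof.
have h1 : p - q <= `|p - q| := ler_norm _.
have h2 : - (p - q) <= `|p - q| by rewrite -normrN ler_norm.
rewrite ler_norml; move: h1 h2; move: `|p - q| => M h1 h2.
by case: (lerP c p); case: (lerP c q) => *; apply/andP; split; lra.
Qed.

Lemma min_lip (R : realType) (c p q : R) :
  `|Num.min c p - Num.min c q| <= `|p - q|.
Proof.
have h1 : p - q <= `|p - q| := ler_norm _.
have h2 : - (p - q) <= `|p - q| by rewrite -normrN ler_norm.
rewrite ler_norml; move: h1 h2; move: `|p - q| => M h1 h2.
by case: (lerP c p); case: (lerP c q) => *; apply/andP; split; lra.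
Qed.

Lemma ramp_lip (R : realType) (v : R) n (x y : R) : 0 <= x -> 0 <= y ->
  `|ramp v n x - ramp v n y| <= n%:R * `|x - y|.
Proof.
move=> x0 y0; have := exp_loss_lip x0 y0; rewrite mul1r /ramp => le.
apply: (le_trans (min_lip _ _ _)); rewrite -mulrBr normrM ger0_norm// ler_wpM2l//.
apply: le_trans le; apply: (le_trans (max_lip _ _ _)).
have -> : exp_loss x - v - (exp_loss y - v) = exp_loss x - exp_loss y by ring.
by [].

Qed.

Lemma cvg_ramp_dyadic (R : realType) (v al : R) n : 0 <= al -> 0 < v ->
  2 ^+ k * ramp v n (al / 2 ^+ k) @[k --> \oo] --> 0.
Proof.
move=> al0 v0; apply: cvg_near_cst; near=> k.
rewrite ramp_eq0 ?mulr0//.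
have [_ _ h _] := exp_loss_bounds (divr_ge0 al0 (ltW (exp2n_gt0 R k))).
apply: (le_trans h).
near: k; apply: (cvgr_le 0) => //.
by rewrite -[X in _ --> X](mulr0 al); apply: cvgM; [exact: cvg_cst|exact: cvg_inv_exp2].
Unshelve. all: by end_near.
Qed.

Lemma ramp_nd (R : realType) (v x : R) :
  {homo (fun n => ramp v n x) : n m / (n <= m)%N >-> n <= m}.
Proof.
move=> n m nm; rewrite /ramp le_min ge_min lexx/= ge_min ler_wpM2r ?orbT//.
  by rewrite le_max lexx.
by rewrite ler_nat.
Qed.

Lemma cvg_ramp (R : realType) (v x : R) :
  ramp v n x @[n --> \oo] --> ((v < exp_loss x)%R%:R : R).
Proof.
case: ltP => h; last by under eq_fun do rewrite ramp_eq0//; exact: cvg_cst.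
apply: cvg_near_cst; near=> n.
rewrite /ramp; have -> : Num.max 0 (exp_loss x - v) = exp_loss x - v.
  by apply/max_idPr; rewrite subr_ge0 ltW.
apply/min_idPl; rewrite -ler_pdivrMr ?subr_gt0//.
near: n; exact: nbhs_infty_ger.
Unshelve. all: by end_near.
Qed.

Lemma measurable_ramp (R : realType) (v : R) n : measurable_fun [set: R] (ramp v n).
Proof.
apply: measurable_minr => //; apply: measurable_funM => //; apply: measurable_maxr => //.
by apply: measurable_funB => //; exact: measurable_exp_loss.
Qed.

Lemma esumZl (R : realType) (I : choiceType) (A : set I) (f : I -> R) (c : R) : 0 < c ->
  (\esum_(x in A) (c * f x)%:E = c%:E * \esum_(x in A) (f x)%:E)%E.
Proof.
move=> c0.
have le (c' : R) (g : I -> R) : 0 < c' ->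
    (\esum_(x in A) (c' * g x)%:E <= c'%:E * \esum_(x in A) (g x)%:E)%E.
  move=> c'0; apply: esum_le_seq => s us hs; rewrite -mulr_sumr EFinM.
  by rewrite lee_pmul2l// ?lte_fin//; exact: esum_ge_seq.
apply/eqP; rewrite eq_le le//=.
(* The reverse inequality is the same bound for the factor [c^-1] and the terms [c * f x]. *)
have := le c^-1 (fun x => c * f x); rewrite invr_gt0 => /(_ c0).
under eq_esum do rewrite mulKf ?gt_eqF//.
rewrite -(@lee_pmul2l _ c%:E)// ?lte_fin// muleA -EFinM divff ?gt_eqF//.
by rewrite mul1e.
Qed.

(** Used with [D] and [Delta] the opposites of a coordinate of [L] and of its jumps, which makes all
    terms nonnegative. The set [Om] is the complement of a null set, as [is_drift] holds almost
    surely, and time stops at 1, the period over which [is_jump_measure] counts. *)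
Definition jump_repr (T : Type) (R : realType) (Om : set T) (al : R)
    (D Delta : R -> T -> R) : Prop :=
  forall w, Om w -> (forall x, 0 < x <= 1 -> 0 <= Delta x w) /\
    (forall t, 0 <= t <= 1 -> (D t w)%:E =
      ((al * t)%:E + \esum_(x in `]0%R, t]%classic) (Delta x w)%:E)%E).

Lemma measurable_dyadic_sum d (T : measurableType d) (R : realType) (f : R -> R)
    (D : R -> T -> R) k :
  measurable_fun [set: R] f -> (forall t, 0 <= t -> measurable_fun [set: T] (D t)) ->
  measurable_fun [set: T] (fun w => dyadic_sum f (D^~ w) k).
Proof.
move=> mf mD; apply: measurable_sum => j; apply: measurableT_comp => //.
by apply: measurable_funB; apply: mD; rewrite divr_ge0// exprn_ge0.
Qed.

(* The sum over the jumps is a limit of measurable functions of finitely many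
   increments. *)
Lemma measurable_jump_sum d (T : measurableType d) (R : realType) (Om : set T) (al : R)
    (D Delta : R -> T -> R) (f : R -> R) (K b : R) :
  measurable Om -> jump_repr Om al D Delta ->
  (forall t, 0 <= t -> measurable_fun [set: T] (D t)) ->
  0 <= K -> 0 <= al -> f 0 = 0 -> (forall x, 0 <= x -> 0 <= f x) ->
  (forall x y, 0 <= x -> 0 <= y -> `|f x - f y| <= K * `|x - y|) ->
  2 ^+ k * f (al / 2 ^+ k) @[k --> \oo] --> b -> measurable_fun [set: R] f ->
  measurable_fun Om (fun w => \esum_(x in `]0%R, 1%R]%classic) (f (Delta x w))%:E).
Proof.
move=> mOm hD mD K0 al0 f0 fge0 fK fal mf.
apply: (emeasurable_fun_cvg (fun k w => (dyadic_sum f (D^~ w) k - b)%:E)) => [k|w Omw].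
  apply/measurable_EFinP; apply: measurable_funB => //.
  by apply: measurable_funTS; exact: measurable_dyadic_sum.
have [D0 Drep] := hD _ Omw.
have [S [-> cv]] := cvg_dyadic_sum K0 al0 f0 fge0 fK fal D0 Drep.
apply/cvg_EFin; first exact: nearW.
rewrite /= -[X in _ --> X](addKr b) addrC; apply: cvgB => //; exact: cvg_cst.
Qed.

(** The indicator is not Lipschitz, so [measurable_jump_sum] is applied to the ramps that increase
    to it. As [v > 0], the ramps vanish near 0 and their drift contribution [b] is 0. *)
Lemma measurable_jump_count d (T : measurableType d) (R : realType) (Om : set T) (al v : R)
    (D Delta : R -> T -> R) :
  measurable Om -> jump_repr Om al D Delta -> 0 <= al -> 0 < v ->
  (forall t, 0 <= t -> measurable_fun [set: T] (D t)) ->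
  measurable_fun Om (fun w => \esum_(x in `]0%R, 1%R]%classic)
    ((v < exp_loss (Delta x w))%R%:R%:E : \bar R)).
Proof.
move=> mOm hD al0 v0 mD.
apply: (emeasurable_fun_cvg (fun n w =>
  \esum_(x in `]0%R, 1%R]%classic) (ramp v n (Delta x w))%:E)) => [n|w Omw].
  apply: (measurable_jump_sum (K := n%:R) (b := 0) mOm hD) => //.
  - by rewrite ramp_eq0// exp_loss0 ltW.
  - by move=> x _; exact: ramp_ge0.
  - by move=> x y; exact: ramp_lip.
  - exact: cvg_ramp_dyadic.
  - exact: measurable_ramp.
apply: (cvg_esum_nondecreasing (f := fun n x => ramp v n (Delta x w))) => x _.
  exact: ramp_nd.
exact: cvg_ramp.
Qed.

Lemma integral_step_approx d (S : measurableType d) (R : realType)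
    (mu : {measure set S -> \bar R}) (D : set S) (y : S -> R) n :
  measurable D -> measurable_fun D y ->
  (\int[mu]_(z in D) (step_approx n (y z))%:E =
   \sum_(j < (2 ^ n)%N) (2 ^- n)%:E * mu (D `&` [set z | (j.+1%:R / 2 ^+ n < y z)%R]))%E.
Proof.
move=> mD my.
have mI v : measurable (D `&` [set z | v < y z]).
  by have := my mD _ (measurable_itv `]v, +oo[); rewrite preimage_itvoy.
pose A (j : 'I_(2 ^ n)) := D `&` [set z | (j.+1%:R / 2 ^+ n < y z)%R].
transitivity (\int[mu]_(z in D) (\sum_(j < (2 ^ n)%N) (2 ^- n)%:E * (\1_(A j) z)%:E))%E.
  apply: eq_integral => z zD; rewrite /step_approx -sumEFin; apply: eq_bigr => j _.
  rewrite -EFinM indicE; congr (_ * _%:R)%:E; rewrite /A in_setI zD /=.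
  by congr nat_of_bool; apply/idP/idP; rewrite inE.
rewrite ge0_integral_sum//; last first.
  move=> j; under eq_fun do rewrite -EFinM; apply/measurable_EFinP.
  by apply: measurable_funM => //; apply: measurable_indic; exact: mI.
apply: eq_bigr => j _; rewrite ge0_integralZl//.
- by rewrite integral_indic//; [rewrite /A setIAC setIid|exact: mI].
- by apply/measurable_EFinP; apply: measurable_indic; exact: mI.
Qed.

(** The last hypothesis is the case of the indicators of [v < exp_loss]. Linearity extends it to
    [step_approx n], and monotone convergence on both sides to [exp_loss] itself. *)
Lemma integral_exp_loss_jumps d (T : measurableType d) d' (S : measurableType d')
    (R : realType) (P : {measure set T -> \bar R}) (mu : {measure set S -> \bar R})
    (Om : set T) (al : R) (D Delta : R -> T -> R) (O : set S) (zeta : S -> R) :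
  measurable Om -> jump_repr Om al D Delta -> 0 <= al ->
  (forall t, 0 <= t -> measurable_fun [set: T] (D t)) ->
  measurable O -> measurable_fun O zeta -> (forall z, O z -> 0 <= zeta z) ->
  (forall v : R, (0 < v)%R -> mu (O `&` [set z | (v < exp_loss (zeta z))%R]) =
    \int[P]_(w in Om) \esum_(x in `]0%R, 1%R]%classic)
      ((v < exp_loss (Delta x w))%R%:R%:E : \bar R))%E ->
  (\int[mu]_(z in O) (exp_loss (zeta z))%:E =
   \int[P]_(w in Om) \esum_(x in `]0%R, 1%R]%classic) (exp_loss (Delta x w))%:E)%E.
Proof.
move=> mOm hD al0 mD mO mzeta zeta0 hmu.
have v_gt0 n j : 0 < j.+1%:R / 2 ^+ n :> R by rewrite divr_gt0// exp2n_gt0.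
have y01 (x : R) : 0 <= x -> 0 <= exp_loss x <= 1 by move=> /exp_loss_bounds[-> ->].
have my : measurable_fun O (fun z => exp_loss (zeta z)).
  by apply: measurableT_comp mzeta; exact: measurable_exp_loss.
have step_eq n :
  (\int[mu]_(z in O) (step_approx n (exp_loss (zeta z)))%:E =
   \int[P]_(w in Om) \esum_(x in `]0%R, 1%R]%classic)
     (step_approx n (exp_loss (Delta x w)))%:E)%E.
  rewrite integral_step_approx//.
  transitivity (\sum_(j < (2 ^ n)%N) \int[P]_(w in Om) ((2 ^- n)%:E *
    \esum_(x in `]0%R, 1%R]%classic)
      ((j.+1%:R / 2 ^+ n < exp_loss (Delta x w))%R%:R%:E : \bar R)))%E.
    apply: eq_bigr => j _; rewrite hmu// ge0_integralZl//.
    - exact: (measurable_jump_count mOm hD).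
    - by move=> w _; exact: esum_ge0.
  rewrite -ge0_integral_sum//; last first.
  - by move=> j w _; rewrite mule_ge0// ?lee_fin ?invr_ge0 ?exprn_ge0//; exact: esum_ge0.
  - by move=> j; apply: emeasurable_funM => //; exact: (measurable_jump_count mOm hD).
  apply: eq_integral => w _.
  under [RHS]eq_esum do rewrite /step_approx -sumEFin.
  rewrite esum_sum; last by move=> *; rewrite lee_fin mulr_ge0// invr_ge0 exprn_ge0.
  by apply: eq_bigr => j _; rewrite esumZl// invr_gt0 exp2n_gt0.
have cv1 : (\int[mu]_(z in O) (step_approx n (exp_loss (zeta z)))%:E @[n --> \oo] -->
    \int[mu]_(z in O) (exp_loss (zeta z))%:E)%E.
  rewrite [X in _ --> X](_ : _ =
      \int[mu]_(z in O) limn (fun n => (step_approx n (exp_loss (zeta z)))%:E))%E.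
    apply: cvg_monotone_convergence => //.
    - move=> n; apply/measurable_EFinP; apply: measurable_sum => j.
      apply: measurable_funM => //.
      rewrite [X in measurable_fun _ X](_ : _ =
        \1_(`]j.+1%:R / 2 ^+ n, +oo[%classic : set R) \o (fun z => exp_loss (zeta z))).
        by apply: measurableT_comp my; apply: measurable_indic.
      apply/funext => z; rewrite /= indicE; congr _%:R.
      by congr nat_of_bool; apply/idP/idP; rewrite inE /= in_itv /= andbT.
    - by move=> n z _; rewrite lee_fin step_approx_ge0.
    - by move=> z _ n m nm; rewrite lee_fin step_approx_nd.
  apply: eq_integral => z; rewrite inE => /zeta0/y01 z01; apply/esym/cvg_lim => //.
  by apply/cvg_EFin; [exact: nearW|exact: cvg_step_approx].
have cv2 : ((\int[P]_(w in Om) \esum_(x in `]0%R, 1%R]%classic)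
     (step_approx n (exp_loss (Delta x w)))%:E) @[n --> \oo] -->
   \int[P]_(w in Om) \esum_(x in `]0%R, 1%R]%classic) (exp_loss (Delta x w))%:E)%E.
  rewrite [X in _ --> X](_ : _ = \int[P]_(w in Om) limn (fun n =>
     \esum_(x in `]0%R, 1%R]%classic) (step_approx n (exp_loss (Delta x w)))%:E))%E.
    apply: cvg_monotone_convergence => //.
    - move=> n.
      rewrite [X in measurable_fun _ X](_ : _ = fun w => (\sum_(j < (2 ^ n)%N) (2 ^- n)%:E *
          \esum_(x in `]0%R, 1%R]%classic)
            ((j.+1%:R / 2 ^+ n < exp_loss (Delta x w))%R%:R%:E : \bar R))%E).
        apply: emeasurable_sum => j; apply: emeasurable_funM => //.
        exact: (measurable_jump_count mOm hD).
      apply/funext => w.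
      under eq_esum do rewrite /step_approx -sumEFin.
      rewrite esum_sum; last by move=> *; rewrite lee_fin mulr_ge0// invr_ge0 exprn_ge0.
      by apply: eq_bigr => j _; rewrite esumZl// invr_gt0 exp2n_gt0.
    - by move=> n w _; apply: esum_ge0 => x _; rewrite lee_fin step_approx_ge0.
    - by move=> w _ n m nm; apply: le_esum => x _; rewrite lee_fin step_approx_nd.
  apply: eq_integral => w; rewrite inE => /hD [Delta0 _]; apply/esym/cvg_lim => //.
  apply: (cvg_esum_nondecreasing (f := fun n x => step_approx n (exp_loss (Delta x w)))) => x.
    by move=> _ n m nm; exact: step_approx_nd.
  by rewrite /= in_itv /= => /Delta0/y01; exact: cvg_step_approx.
move: cv1; rewrite (_ : (fun n => _) = (fun n => \int[P]_(w in Om)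
   \esum_(x in `]0%R, 1%R]%classic) (step_approx n (exp_loss (Delta x w)))%:E))%E.
  by move=> cv1; apply: (cvg_unique _ cv1 cv2).
by apply/funext => n; exact: step_eq.
Qed.

(** * Laplace exponents *)

(* Here [f] need not be measurable: the number of jumps is only known to be measurable
   off a null set. *)
Lemma ge0_integral_setC_null d (T : measurableType d) (R : realType)
    (mu : {measure set T -> \bar R}) (N : set T) (f : T -> \bar R) :
  measurable N -> mu N = 0%E -> (forall w, 0 <= f w)%E ->
  (\int[mu]_w f w = \int[mu]_(w in ~` N) f w)%E.
Proof.
move=> mN N0 f0; have mC := measurableC mN.
rewrite ge0_integralTE// ge0_integralE//.
apply/eqP; rewrite eq_le; apply/andP; split.
  apply: ge_ereal_sup => _ [h hf <-].
  (* A simple function below [f] is cut off on [N]; this makes it admissible for the integral over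
     the complement and, since [N] is null, leaves its own integral unchanged. *)
  apply: ereal_sup_ubound; exists (proj_nnsfun h mC).
    move=> w; rewrite -mrestrict /patch; case: ifP => _ //; exact: hf.
  rewrite -!integralT_nnsfun; apply: ge0_ae_eq_integral => //.
  - by apply/measurable_EFinP; exact: measurable_funPT.
  - by apply/measurable_EFinP; exact: measurable_funPT.
  - by move=> x _; rewrite lee_fin.
  - by move=> x _; rewrite lee_fin.
  exists N; split=> // w; apply: contra_notP => Nw _ /=.
  by rewrite mindicE mem_set// mulr1.
apply: ge_ereal_sup => _ [h hf <-].
apply: ereal_sup_ubound; exists h => // w; apply: (le_trans (hf w)).
by rewrite /patch; case: ifP.
Qed.

(** The absolute values make the integrand nonnegative on the whole line, so the image measure
    formula applies without an integrability condition; in the uses the variables are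
    exponentials. *)
Lemma ge0_integral_law_eq d (T : measurableType d) (R : realType) (P : probability T R)
    (U V : T -> R) :
  measurable_fun [set: T] U -> measurable_fun [set: T] V ->
  (forall B, measurable B -> P (U @^-1` B) = P (V @^-1` B)) ->
  (\int[P]_w (`|U w|)%:E = \int[P]_w (`|V w|)%:E)%E.
Proof.
move=> mU mV UV.
have mabs : measurable_fun [set: R] (fun x : R => `|x|%:E).
  by apply/measurable_EFinP; exact: normr_measurable.
have abs0 : {in [set: R], forall x : R, (0 <= (`|x|)%:E)%E}.
  by move=> x _; rewrite lee_fin.
have hU := ge0_integral_pushforward mU P measurableT mabs abs0.
have hV := ge0_integral_pushforward mV P measurableT mabs abs0.
rewrite preimage_setT in hU; rewrite preimage_setT in hV.
rewrite -[LHS]hU -[RHS]hV; apply: eq_measure_integral => B mB _.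
exact: UV.
Qed.

(** The joint law agrees with the product of the marginals on rectangles, hence is that product;
    Tonelli then factorises the integral. *)
Lemma ge0_integral_indep d (T : measurableType d) (R : realType) (P : probability T R)
    (Z V : T -> R) :
  measurable_fun [set: T] Z -> measurable_fun [set: T] V ->
  (forall B C, measurable B -> measurable C ->
     P (Z @^-1` B `&` V @^-1` C) = P (Z @^-1` B) * P (V @^-1` C))%E ->
  (\int[P]_w (`|Z w| * `|V w|)%:E = \int[P]_w `|Z w|%:E * \int[P]_w `|V w|%:E)%E.
Proof.
move=> mZ mV ind.
pose Zm : {mfun T >-> R} := HB.pack Z (isMeasurableFun.Build _ _ _ _ Z mZ).
pose Vm : {mfun T >-> R} := HB.pack V (isMeasurableFun.Build _ _ _ _ V mV).
have mZV : measurable_fun [set: T] (fun w => (Z w, V w)) by exact: measurable_fun_pair.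
pose m1 : probability R R := distribution P Zm.
pose m2 : probability R R := distribution P Vm.
pose m' := pushforward P (fun w => (Z w, V w)).
have mabs : measurable_fun [set: R] (fun x : R => `|x|%:E).
  by apply/measurable_EFinP; exact: normr_measurable.
have abs0 : {in [set: R], forall x : R, (0 <= (`|x|)%:E)%E}.
  by move=> x _; rewrite lee_fin.
pose f (z : R * R) : \bar R := (`|z.1| * `|z.2|)%:E.
have mf : measurable_fun [set: R * R] f.
  apply/measurable_EFinP; apply: measurable_funM.
    by apply: measurableT_comp => //; exact: normr_measurable.
  by apply: measurableT_comp => //; exact: normr_measurable.
have f0 z : (0 <= f z)%E by rewrite lee_fin mulr_ge0.
have -> : (\int[P]_w (`|Z w| * `|V w|)%:E = \int[m']_z f z)%E.
  by rewrite ge0_integral_pushforward//.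
have -> : (\int[m']_z f z = \int[m1 \x m2]_z f z)%E.
  apply: eq_measure_integral => B mB _; symmetry.
  apply: product_measure_unique => //.
rewrite fubini_tonelli1//.
have -> : fubini_F m2 f = (fun x => `|x|%:E * \int[m2]_v `|v|%:E)%E.
  apply/funext => x; rewrite /fubini_F -ge0_integralZl//.
rewrite ge0_integralZr//; last by apply: integral_ge0.
by congr (_ * _)%E; rewrite ge0_integral_pushforward.
Qed.

Lemma bounded_integrable d (T : measurableType d) (R : realType) (P : probability T R)
    (f : T -> R) (M : R) :
  measurable_fun [set: T] f -> (forall w, `|f w| <= M) ->
  P.-integrable [set: T] (EFin \o f).
Proof.
move=> mf fM; apply: measurable_bounded_integrable => //.
  exact: (le_lt_trans (probability_le1 P measurableT) (ltry 1)).
exists M; split; first by rewrite num_real.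
by move=> x Mx w _ /=; rewrite (le_trans (fM w))// ltW.
Qed.

Lemma natural_filtration_measurable d (T : measurableType d) (R : realType)
    (P : probability T R) m (L : 'I_m -> R -> T -> R) t A :
  levy_process P L -> natural_filtration L t A -> measurable A.
Proof.
move=> hL; apply: smallest_sub; first exact: sigma_algebra_measurable.
move=> _ [i [s [B [/andP[s0 _] mB ->]]]].
by rewrite -[_ @^-1` _]setTI; apply: (levy_measurable hL).
Qed.

(* [natural_filtration L t] is convertible to the sigma-algebra of
   [g_sigma_algebraType (filtration_gen L t)]. *)
Definition filtration_gen (T : Type) (R : realType) m (L : 'I_m -> R -> T -> R) (t : R) :
    set (set T) :=
  [set A | exists (i : 'I_m) (s : R) (B : set R),
         [/\ 0 <= s <= t, measurable B & A = L i s @^-1` B]].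

Lemma measurable_coord_filtration d (T : measurableType d) (R : realType)
    m (L : 'I_m -> R -> T -> R) i s t :
  0 <= s <= t ->
  measurable_fun [set: g_sigma_algebraType (filtration_gen L t)]
    (L i s : g_sigma_algebraType (filtration_gen L t) -> R).
Proof.
move=> st _ B mB; rewrite setTI; apply: sub_sigma_algebra.
by exists i, s, B.
Qed.

(* The moment generating function of [X t] at 1. *)
Definition mgf d (T : measurableType d) (R : realType) (P : probability T R)
    (X : R -> T -> R) (t : R) : R := \int[P]_w expR (X t w).

Lemma subordinator_le0 d (T : measurableType d) (R : realType) (P : probability T R)
  m (L : 'I_m -> R -> T -> R) :
  levy_process P L -> (forall i, negative_subordinator P (L i)) ->
  forall i t w, 0 <= t -> L i t w <= 0.
Proof.
by move=> hL hs i t w t0; rewrite -(levy_start0 hL i w); apply: (hs i).2.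
Qed.

Lemma exp_levy_le1 d (T : measurableType d) (R : realType) (P : probability T R)
  m (L : 'I_m -> R -> T -> R) :
  levy_process P L -> (forall i, negative_subordinator P (L i)) ->
  forall i t w, 0 <= t -> expR (L i t w) <= 1.
Proof.
by move=> hL hs i t w t0; rewrite -expR0 ler_expR; exact: subordinator_le0 hL hs _ _ _ _.
Qed.

Lemma measurable_exp_levy d (T : measurableType d) (R : realType) (P : probability T R)
  m (L : 'I_m -> R -> T -> R) :
  levy_process P L -> forall i t, 0 <= t ->
  measurable_fun [set: T] (fun w => expR (L i t w)).
Proof.
by move=> hL i t t0; apply: measurableT_comp => //; exact: levy_measurable hL _ _ t0.
Qed.

Lemma measurable_exp_tnth (R : realType) m (i : 'I_m) (C : set R) :
  measurable C -> measurable [set z : m.-tuple R | C (expR (tnth z i))].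
Proof.
move=> mC; rewrite -[X in measurable X]setTI.
have : measurable_fun [set: m.-tuple R] (fun z : m.-tuple R => expR (tnth z i)).
  by apply: measurableT_comp => //; exact: measurable_tnth.
by move=> /(_ measurableT C mC).
Qed.

Lemma exp_increment_preimage (T : Type) (R : realType) m (L : 'I_m -> R -> T -> R)
    (i : 'I_m) (s t : R) (C : set R) :
  (fun w => expR (L i t w - L i s w)) @^-1` C =
  increment L s t @^-1` [set z | C (expR (tnth z i))].
Proof. by apply/funext => w /=; rewrite /increment tnth_mktuple. Qed.

Lemma exp_increment_law d (T : measurableType d) (R : realType) (P : probability T R)
    m (L : 'I_m -> R -> T -> R) (i : 'I_m) (s h : R) (B : set R) :
  levy_process P L -> 0 <= s -> 0 <= h -> measurable B ->
  P ((fun w => expR (L i (s + h) w - L i s w)) @^-1` B) =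
  P ((fun w => expR (L i h w)) @^-1` B).
Proof.
move=> hL s0 h0 mB; rewrite exp_increment_preimage (levy_stationary hL)//.
  congr (P _); rewrite -exp_increment_preimage; apply/funext => w /=.
  by rewrite (levy_start0 hL) subr0.
exact: measurable_exp_tnth.
Qed.

(** Write [exp (L^i_(s+h))] as [exp (L^i_s)] times the exponential of the increment. The first
    factor and [A] belong to the past at [s], while the increment is independent of that past and
    distributed as [L^i_h]. *)
Lemma mgf_increment d (T : measurableType d) (R : realType) (P : probability T R)
    m (L : 'I_m -> R -> T -> R) (i : 'I_m) (s h : R) (A : set T) :
  levy_process P L -> (forall i, negative_subordinator P (L i)) ->
  0 <= s -> 0 <= h -> natural_filtration L s A ->
  \int[P]_w (\1_A w * expR (L i (s + h) w)) =
  \int[P]_w (\1_A w * expR (L i s w)) * mgf P (L i) h.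
Proof.
move=> hL hs s0 h0 FA; have mA := natural_filtration_measurable hL FA.
have sh0 : 0 <= s + h by rewrite addr_ge0.
have mI u : 0 <= u -> measurable_fun [set: T] (L i u) by move=> u0; exact: levy_measurable hL _ _ u0.
pose Z w : R := \1_A w * expR (L i s w).
pose V w : R := expR (L i (s + h) w - L i s w).
have mZ : measurable_fun [set: T] Z.
  by apply: measurable_funM; [exact: measurable_indic|exact: measurable_exp_levy hL _ _ s0].
have mV : measurable_fun [set: T] V.
  by apply: measurableT_comp => //; apply: measurable_funB; exact: mI.
have ind B C : measurable B -> measurable C ->
     (P (Z @^-1` B `&` V @^-1` C) = P (Z @^-1` B) * P (V @^-1` C))%E.
  move=> mB mC; rewrite /V exp_increment_preimage; apply: (levy_independent hL) => //;
    [by rewrite lerDl| |exact: measurable_exp_tnth].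
  (* [levy_independent] asks for events of the past, so [Z] has to be measurable for the
     sigma-algebra at time [s] and not merely for the ambient one. *)
  have mZ' : measurable_fun [set: g_sigma_algebraType (filtration_gen L s)]
      (Z : g_sigma_algebraType (filtration_gen L s) -> R).
    apply: measurable_funM; first exact: measurable_indic.
    apply: measurableT_comp => //; apply: measurable_coord_filtration.
    by rewrite s0 lexx.
  by have := mZ' measurableT B mB; rewrite setTI.
have law B (mB : measurable B) := exp_increment_law i hL s0 h0 mB.
have E1 := ge0_integral_indep mZ mV ind.
have E2 := ge0_integral_law_eq mV (measurable_exp_levy hL i h0) law.
have Z0 w : 0 <= Z w by rewrite mulr_ge0// expR_ge0.
have ZM w : `|Z w| <= 1.
  rewrite ger0_norm// mulr_ile1 ?expR_ge0//; exact: exp_levy_le1 hL hs _ _ _ _.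
have finZ : (\int[P]_w (Z w)%:E)%E \is a fin_num.
  apply: integrable_fin_num => //; exact: (bounded_integrable P mZ ZM).
rewrite /mgf /Rintegral -fineM//; last first.
  apply: integrable_fin_num => //; apply: (@bounded_integrable _ _ _ _ _ 1).
    exact: measurable_exp_levy hL _ _ h0.
  by move=> w; rewrite ger0_norm ?expR_ge0//; exact: exp_levy_le1 hL hs _ _ _ _.
congr fine.
transitivity (\int[P]_w (`|Z w| * `|V w|)%:E)%E.
  apply: eq_integral => w _; congr EFin.
  rewrite !ger0_norm ?expR_ge0// /Z /V -mulrA -expRD subrKC//.
rewrite E1 E2; congr (_ * _)%E; apply: eq_integral => w _; congr EFin.
  by rewrite ger0_norm.
by rewrite ger0_norm// expR_ge0.
Qed.

Lemma mgf_gt0_le1 d (T : measurableType d) (R : realType) (P : probability T R)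
    m (L : 'I_m -> R -> T -> R) (i : 'I_m) (t : R) :
  levy_process P L -> (forall i, negative_subordinator P (L i)) -> 0 <= t ->
  0 < mgf P (L i) t <= 1.
Proof.
move=> hL hs t0.
have mE := measurable_exp_levy hL i t0.
have le1 w : expR (L i t w) <= 1 := exp_levy_le1 hL hs i w t0.
have nle1 w : `|expR (L i t w)| <= 1 by rewrite ger0_norm ?expR_ge0.
have iE := bounded_integrable P mE nle1.
apply/andP; split; last first.
  have -> : 1 = \int[P]_(w in [set: T]) 1 :> R.
    by rewrite /Rintegral integral_cst//= mul1e probability_setT.
  apply: le_Rintegral => //.
  by apply: (@bounded_integrable _ _ _ P (cst 1) 1) => //= w; rewrite normr1.
rewrite lt0r Rintegral_ge0 ?andbT; last by move=> w _; exact: expR_ge0.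
(* A nonnegative function with mean 0 vanishes off a null set; as an exponential never vanishes,
   that null set would be the whole space. Positivity is what permits taking the logarithm. *)
apply/eqP => mgf0.
have : (\int[P]_w (expR (L i t w))%:E = 0)%E.
  by rewrite -[LHS]fineK ?integrable_fin_num//; congr EFin.
have -> : (\int[P]_w (expR (L i t w))%:E = \int[P]_w `|(expR (L i t w))%:E|)%E.
  by apply: eq_integral => w _; rewrite gee0_abs// lee_fin expR_ge0.
move/ae_eq_integral_abs => /(_ measurableT) [|N [mN N0 sub]].
  exact/measurable_EFinP.
have : (P [set: T] <= P N)%E.
  apply: le_measure; rewrite ?inE// => w _; apply: sub => /= /(_ I) [] /eqP.
  by rewrite gt_eqF// expR_gt0.
by rewrite N0 probability_setT lee_fin ler10.
Qed.

(** By multiplicativity the [2^k]-th power of [mgf (2^-k)] is [mgf 1]. With [phi = - ln (mgf 1)]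
    both sides are nonnegative and have the same [2^k]-th power. *)
Lemma mgf_expR d (T : measurableType d) (R : realType) (P : probability T R)
    m (L : 'I_m -> R -> T -> R) (i : 'I_m) :
  levy_process P L -> (forall i, negative_subordinator P (L i)) ->
  exists2 phi, 0 <= phi & forall k, mgf P (L i) (2 ^- k) = expR (- (phi / 2 ^+ k)).
Proof.
move=> hL hs.
have mul s h : 0 <= s -> 0 <= h -> mgf P (L i) (s + h) = mgf P (L i) s * mgf P (L i) h.
  move=> s0 h0.
  have FT : natural_filtration L s [set: T].
    by have := @measurableT _ (g_sigma_algebraType (filtration_gen L s)).
  have := mgf_increment i hL hs s0 h0 FT.
  have E u : \int[P]_w (\1_[set: T] w * expR (L i u w)) = mgf P (L i) u.
    by apply: eq_Rintegral => w _; rewrite indicT mul1r.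
  by rewrite !E.
have mul_n n h : 0 <= h -> mgf P (L i) (n.+1%:R * h) = mgf P (L i) h ^+ n.+1.
  move=> h0; elim: n => [|n IH]; first by rewrite mul1r expr1.
  by rewrite -natr1 mulrDl mul1r mul ?mulr_ge0// IH -exprSr.
have /andP[m0 m1] := mgf_gt0_le1 i hL hs (@ler01 R).
exists (- ln (mgf P (L i) 1)); first by rewrite oppr_ge0 ln_le0.
move=> k; have k0 := exp2n_gt0 R k.
have kge : 0 <= 2 ^- k :> R by rewrite invr_ge0 ltW.
have /andP[mk0 mk1] := mgf_gt0_le1 i hL hs kge.
have n2 : (0 < 2 ^ k)%N by rewrite expn_gt0.
apply/eqP; rewrite -(eqrXn2 n2) ?expR_ge0 ?ltW//; apply/eqP.
rewrite -(prednK n2) -mul_n// -expRM_natl prednK// natrX divff ?gt_eqF//.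
by rewrite mulrN mulrCA divff ?gt_eqF// mulr1 opprK lnK.
Qed.

Lemma dyadic_sum_exp_loss_nd (R : realType) (D : R -> R) :
  (forall s t, 0 <= s -> s <= t -> D s <= D t) ->
  {homo (fun k => dyadic_sum (@exp_loss R) D k) : n m / (n <= m)%N >-> n <= m}.
Proof.
move=> Dnd; apply/nondecreasing_seqP => k; rewrite /dyadic_sum expnS mul2n.
rewrite (big_double (fun j : nat => exp_loss (D (j.+1%:R / 2 ^+ k.+1) - D (j%:R / 2 ^+ k.+1)))).
apply: ler_sum => j _.
have dbl (n : nat) : n.*2%:R / 2 ^+ k.+1 = n%:R / 2 ^+ k :> R.
  by rewrite -mul2n natrM exprS; field; rewrite gt_eqF ?exp2n_gt0.
rewrite -doubleS !dbl.
have g0 (n : nat) l : 0 <= n%:R / 2 ^+ l :> R by rewrite divr_ge0// exprn_ge0.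
have h1 := dyadic_step_ge0 R k.+1 j.*2; have h2 := dyadic_step_ge0 R k.+1 j.*2.+1.
move: h1 h2; rewrite -doubleS !dbl => /Dnd h1 /Dnd h2.
have -> : D (j.+1%:R / 2 ^+ k) - D (j%:R / 2 ^+ k) =
  (D (j.*2.+1%:R / 2 ^+ k.+1) - D (j%:R / 2 ^+ k)) +
  (D (j.+1%:R / 2 ^+ k) - D (j.*2.+1%:R / 2 ^+ k.+1)) by ring.
by apply: exp_loss_subadd; rewrite subr_ge0 ?h1 ?h2.
Qed.

Lemma integral_exp_loss_increment d (T : measurableType d) (R : realType)
    (P : probability T R) m (L : 'I_m -> R -> T -> R) (i : 'I_m) (s h : R) :
  levy_process P L -> (forall i, negative_subordinator P (L i)) -> 0 <= s -> 0 <= h ->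
  (\int[P]_w (exp_loss (- L i (s + h) w - - L i s w))%:E = (1 - mgf P (L i) h)%:E)%E.
Proof.
move=> hL hs s0 h0; have sh0 : 0 <= s + h by rewrite addr_ge0.
pose V w : R := expR (L i (s + h) w - L i s w).
have mV : measurable_fun [set: T] V.
  by apply: measurableT_comp => //; apply: measurable_funB; exact: levy_measurable hL _ _ _.
have V1 w : `|V w| <= 1.
  by rewrite ger0_norm ?expR_ge0// -expR0 ler_expR subr_le0; apply: (hs i).2; rewrite ?lerDl.
have iV := bounded_integrable P mV V1.
have -> : (\int[P]_w (exp_loss (- L i (s + h) w - - L i s w))%:E =
   \int[P]_w ((cst 1 w)%:E - (V w)%:E))%E.
  apply: eq_integral => w _; rewrite -EFinB; congr (_ - expR _)%:E; ring.
have i1 : P.-integrable [set: T] (EFin \o (cst 1 : T -> R)).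
  by apply: (@bounded_integrable _ _ _ P _ 1) => //= w; rewrite normr1.
have P1 : (1 * P [set: T] = 1)%E by rewrite mul1e probability_setT.
rewrite integralB//= integral_cst// P1 EFinB; congr (_ - _)%E.
rewrite /mgf /Rintegral fineK; last first.
  apply: integrable_fin_num => //; apply: (@bounded_integrable _ _ _ _ _ 1).
    exact: measurable_exp_levy hL _ _ h0.
  by move=> w; rewrite ger0_norm ?expR_ge0//; exact: exp_levy_le1 hL hs _ _ _ _.
transitivity (\int[P]_w (`|V w|)%:E)%E.
  by apply: eq_integral => w _; rewrite ger0_norm ?expR_ge0.
have law := ge0_integral_law_eq mV (measurable_exp_levy hL i h0)
  (fun B => exp_increment_law i hL s0 h0 (B := B)).
rewrite [LHS]law; apply: eq_integral => w _.
by rewrite ger0_norm ?expR_ge0.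
Qed.

Lemma integral_dyadic_sum d (T : measurableType d) (R : realType)
    (P : probability T R) m (L : 'I_m -> R -> T -> R) (i : 'I_m) (k : nat) :
  levy_process P L -> (forall i, negative_subordinator P (L i)) ->
  (\int[P]_w (dyadic_sum (@exp_loss R) (fun t => - L i t w) k)%:E =
  (2 ^+ k * (1 - mgf P (L i) (2 ^- k)))%:E)%E.
Proof.
move=> hL hs; have k0 : 0 <= 2 ^- k :> R by rewrite invr_ge0 exprn_ge0.
have t0 (j : nat) : 0 <= j%:R / 2 ^+ k :> R by rewrite divr_ge0// exprn_ge0.
pose f (j : 'I_(2 ^ k)) w := (exp_loss (- L i (j.+1%:R / 2 ^+ k) w - - L i (j%:R / 2 ^+ k) w))%:E.
have mf j : measurable_fun [set: T] (f j).
  apply/measurable_EFinP; apply: measurableT_comp; first exact: measurable_exp_loss.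
  by apply: measurable_funB; apply: measurableT_comp => //; exact: levy_measurable hL _ _ _.
have f0 j w : [set: T] w -> (0 <= f j w)%E.
  move=> _; rewrite lee_fin.
  have [] // := @exp_loss_bounds R (- L i (j.+1%:R / 2 ^+ k) w - - L i (j%:R / 2 ^+ k) w) _.
  by rewrite opprK addrC subr_ge0; apply: (hs i).2 => //; exact: dyadic_step_ge0.
have fE j : (\int[P]_w f j w = (1 - mgf P (L i) (2 ^- k))%:E)%E.
  rewrite -(integral_exp_loss_increment i hL hs (t0 j) k0).
  by apply: eq_integral => w _; rewrite /f -natr1 mulrDl mul1r.
transitivity (\int[P]_w (\sum_(j < (2 ^ k)%N) f j w))%E.
  by apply: eq_integral => w _; rewrite /dyadic_sum -sumEFin.
rewrite (ge0_integral_sum P measurableT mf f0).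
rewrite (eq_bigr _ (fun j _ => fE j)) sumEFin sumr_const card_ord.
have e : (2 ^ k)%N%:R = 2 ^+ k :> R := natrX _ _ _.
by rewrite -e mulr_natl.
Qed.

Lemma jump_le0 d (T : measurableType d) (R : realType) (P : probability T R)
    m (L : 'I_m -> R -> T -> R) (i : 'I_m) (s : R) (w : T) :
  levy_process P L -> (forall i, negative_subordinator P (L i)) -> 0 < s ->
  tnth (jump L s w) i <= 0.
Proof.
move=> hL hs s0; rewrite /jump tnth_mktuple subr_le0.
apply: limr_ge; first exact: levy_left_limits hL _ _ _ s0.
near=> u; apply: (hs i).2.
  near: u; exact: nbhs_left_ge.
by near: u; exact: nbhs_left_le.
Unshelve. all: by end_near.
Qed.

Lemma levy_jump_repr d (T : measurableType d) (R : realType) (P : probability T R)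
    m (L : 'I_m -> R -> T -> R) (a : 'I_m -> R) :
  levy_process P L -> (forall i, negative_subordinator P (L i)) -> is_drift P L a ->
  exists N, [/\ measurable N, P N = 0%E & forall i,
    jump_repr (~` N) (- a i) (fun t w => - L i t w) (fun x w => - tnth (jump L x w) i)].
Proof.
move=> hL hs [N [mN N0 sub]]; exists N; split=> // i w Nw; split=> [x /andP[x0 _]|t /andP[t0 _]].
  by rewrite oppr_ge0; exact: jump_le0 hL hs x0.
have : (L i t w)%:E = ((a i * t)%:E
      - \esum_(s in `]0%R, t]%classic) (- tnth (jump L s w) i)%:E)%E.
  have := Nw; rewrite /setC/=; apply: contra_notP => H; apply: sub => /= H'.
  exact: H (H' i t t0).
case: (\esum_(s in _) _)%E => [S| |]//=.
by move=> -[->]; rewrite -EFinD; congr EFin; ring.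
Qed.

Lemma measurable_negative_orthant (R : realType) m :
  measurable (@negative_orthant R m).
Proof.
have -> : negative_orthant = \bigcap_(i in [set: 'I_m]) [set z : m.-tuple R | tnth z i < 0].
  by apply/seteqP; split=> z /= h i; [move=> _|]; apply: h.
apply: fin_bigcap_measurable => // i _.
rewrite -[X in measurable X]setTI.
have := @measurable_tnth _ R m i measurableT _ (measurable_itv `]-oo, 0%R[).
by rewrite preimage_itvNyo.
Qed.

(** [Pi] does not charge the complement of the orthant, so intersecting with it changes nothing. As
    [v > 0] and [exp_loss 0 = 0], a jump above the level is automatically nonzero, which absorbs
    that clause of [is_jump_measure]. *)
Lemma jump_measure_tail d (T : measurableType d) (R : realType) (P : probability T R)
    m (L : 'I_m -> R -> T -> R) (Pi : {measure set (m.-tuple R) -> \bar R})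
    (N : set T) (i : 'I_m) (v : R) :
  measurable N -> P N = 0%E -> is_jump_measure P L Pi ->
  Pi (~` negative_orthant) = 0%E -> 0 < v ->
  (Pi (negative_orthant `&` [set z | (v < exp_loss (- tnth z i))%R]) =
   \int[P]_(w in ~` N) \esum_(x in `]0%R, 1%R]%classic)
     ((v < exp_loss (- tnth (jump L x w) i))%R%:R%:E : \bar R))%E.
Proof.
move=> mN N0 hPi hneg v0; have mO := @measurable_negative_orthant R m.
set B := [set z | _].
have mB : measurable B.
  rewrite -[X in measurable X]setTI.
  have mf : measurable_fun [set: m.-tuple R] (fun z : m.-tuple R => exp_loss (- tnth z i)).
    apply: measurableT_comp; first exact: measurable_exp_loss.
    by apply: measurableT_comp => //; exact: measurable_tnth.
  by have := mf measurableT _ (measurable_itv `]v, +oo[); rewrite preimage_itvoy.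
have -> : Pi (negative_orthant `&` B) = Pi B.
  have BO : Pi (B `\` negative_orthant) = 0%E.
    apply: (subset_measure0 _ (measurableC mO) _ hneg); first exact: measurableD.
    by move=> z [].
  rewrite setIC [RHS](measureDI Pi mB mO) -[LHS]add0e.
  by congr (_ + _)%E; rewrite -[LHS]BO.
rewrite (hPi B mB) -(@ge0_integral_setC_null _ _ _ P N)//; last first.
  by move=> w; exact: esum_ge0.
apply: eq_integral => w _; rewrite esum_indic_counting; congr counting.
apply/seteqP; split=> s /=; rewrite in_itv /=.
  by case.
move=> [s01 Bs]; split=> //; apply/eqP => js.
by move: Bs; rewrite js tnth_mktuple oppr0 exp_loss0 ltNge ltW.
Qed.

Lemma laplace_exponent d (T : measurableType d) (R : realType) (P : probability T R)
    m (L : 'I_m -> R -> T -> R) (a : 'I_m -> R)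
    (Pi : {measure set (m.-tuple R) -> \bar R}) (i : 'I_m) (phi : R) :
  levy_process P L -> (forall i, negative_subordinator P (L i)) ->
  is_jump_measure P L Pi -> Pi (~` negative_orthant) = 0%E ->
  is_drift P L a -> (forall i, a i <= 0) -> 0 <= phi ->
  (forall k, mgf P (L i) (2 ^- k) = expR (- (phi / 2 ^+ k))) ->
  (phi%:E = (- a i)%:E + \int[Pi]_(z in negative_orthant) (exp_loss (- tnth z i))%:E)%E.
Proof.
move=> hL hs hPi hneg ha ha0 phi0 hphi.
have al0 : 0 <= - a i by rewrite oppr_ge0.
have [N [mN N0 /(_ i) hrep]] := levy_jump_repr hL hs ha.
have mOm := measurableC mN.
have mD t : 0 <= t -> measurable_fun [set: T] (fun w => - L i t w).
  by move=> t0; apply: measurableT_comp => //; exact: levy_measurable hL _ _ t0.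
have mzeta : measurable_fun negative_orthant (fun z : m.-tuple R => - tnth z i).
  by apply: measurable_funTS; apply: measurableT_comp => //; exact: measurable_tnth.
have -> : (\int[Pi]_(z in negative_orthant) (exp_loss (- tnth z i))%:E =
   \int[P]_(w in ~` N) \esum_(x in `]0%R, 1%R]%classic)
     (exp_loss (- tnth (jump L x w) i))%:E)%E.
  apply: (integral_exp_loss_jumps (P := P) mOm hrep al0 mD _ mzeta).
  - exact: measurable_negative_orthant.
  - by move=> z Oz; rewrite oppr_ge0 ltW//; exact: Oz.
  - by move=> v v0; exact: (jump_measure_tail i mN N0 hPi hneg v0).
set W := fun w => \esum_(x in `]0%R, 1%R]%classic) (exp_loss (- tnth (jump L x w) i))%:E.
pose V k w := (dyadic_sum (@exp_loss R) (fun t => - L i t w) k)%:E.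
have mV k : measurable_fun [set: T] (V k).
  by apply/measurable_EFinP; apply: measurable_dyadic_sum => //; exact: measurable_exp_loss.
have V0 k w : (0 <= V k w)%E.
  rewrite lee_fin; apply: sumr_ge0 => j _.
  have [] // := @exp_loss_bounds R (- L i (j.+1%:R / 2 ^+ k) w - - L i (j%:R / 2 ^+ k) w) _.
  rewrite opprK addrC subr_ge0; apply: (hs i).2; last exact: dyadic_step_ge0.
  by rewrite divr_ge0// exprn_ge0.
have EV k : (\int[P]_(w in ~` N) V k w = (2 ^+ k * exp_loss (phi / 2 ^+ k))%:E)%E.
  by rewrite -ge0_integral_setC_null// integral_dyadic_sum// hphi.
have Wcvg w : (~` N) w -> V k w @[k --> \oo] --> ((- a i)%:E + W w)%E.
  move=> /hrep [D0 Drep].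
  have e0 : 0 <= 1 :> R by [].
  have fge0 (x : R) : 0 <= x -> 0 <= exp_loss x by move=> /exp_loss_bounds[].
  have [S [WS cv]] := cvg_dyadic_sum e0 al0 (@exp_loss0 R) fge0 (@exp_loss_lip R)
    (cvg_exp_loss_dyadic al0) D0 Drep.
  by rewrite /W WS -EFinD; apply/cvg_EFin => //; exact: nearW.
have cv1 : (\int[P]_(w in ~` N) V k w)%E @[k --> \oo] -->
    (\int[P]_(w in ~` N) ((- a i)%:E + W w))%E.
  rewrite [X in _ --> X](_ : _ = \int[P]_(w in ~` N) limn (V ^~ w))%E.
    apply: cvg_monotone_convergence => //.
    - by move=> k; exact: measurable_funTS.
    - move=> w _ n k nk; rewrite lee_fin.
      apply: dyadic_sum_exp_loss_nd => // s t s0 st; rewrite lerN2; exact: (hs i).2.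
  by apply: eq_integral => w; rewrite inE => /Wcvg h; apply/esym/cvg_lim.
have cv2 : (\int[P]_(w in ~` N) V k w)%E @[k --> \oo] --> phi%:E.
  rewrite (_ : (fun k => _) = fun k => (2 ^+ k * exp_loss (phi / 2 ^+ k))%:E); last first.
    by apply/funext => k; exact: EV.
  by apply/cvg_EFin; [exact: nearW|exact: cvg_exp_loss_dyadic].
have -> : (phi%:E = \int[P]_(w in ~` N) ((- a i)%:E + W w))%E.
  exact: (cvg_unique _ cv2 cv1).
rewrite ge0_integralD//.
- rewrite integral_cst//; congr (_ + _)%E.
  rewrite -[RHS]mule1; congr (_ * _)%E.
  by rewrite -[LHS]/(P (~` N)) probability_setC// N0 sube0.
- move=> w /hrep [D0 _]; apply: esum_ge0 => x; rewrite /= in_itv/= => /D0/exp_loss_bounds[].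
  by rewrite lee_fin.
- have e0 : 0 <= 1 :> R by [].
  apply: (measurable_jump_sum (f := @exp_loss R) (K := 1) (b := - a i) mOm hrep) => //.
  + exact: exp_loss0.
  + by move=> x /exp_loss_bounds[].
  + exact: exp_loss_lip.
  + exact: cvg_exp_loss_dyadic.
  + exact: measurable_exp_loss.
Qed.

Lemma threshold_coefE d (T : measurableType d) (R : realType) (P : probability T R)
    m (L : 'I_m -> R -> T -> R) (r : R) (y a : 'I_m -> R)
    (Pi : {measure set (m.-tuple R) -> \bar R}) (i : 'I_m) (phi : R) :
  levy_process P L -> (forall i, negative_subordinator P (L i)) ->
  is_jump_measure P L Pi -> Pi (~` negative_orthant) = 0%E ->
  is_drift P L a -> (forall i, a i <= 0) -> 0 <= phi ->
  (forall k, mgf P (L i) (2 ^- k) = expR (- (phi / 2 ^+ k))) ->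
  threshold_coef r y a Pi i = y i * (r + phi).
Proof.
move=> hL hs hPi hneg ha ha0 phi0 hphi.
have := laplace_exponent hL hs hPi hneg ha ha0 phi0 hphi.
rewrite /threshold_coef /Rintegral.
have -> : (\int[Pi]_(z in negative_orthant) (expR (tnth z i) - 1)%:E =
   - \int[Pi]_(z in negative_orthant) (exp_loss (- tnth z i))%:E)%E.
  rewrite -integral_ge0N; last first.
    move=> z Oz; rewrite lee_fin; have [] // := @exp_loss_bounds R (- tnth z i) _.
    by rewrite oppr_ge0 ltW//; exact: Oz.
  by apply: eq_integral => z _; rewrite -EFinN /exp_loss opprK opprB.
(* The identity for [phi] holds in the extended reals; since [phi] is real, it excludes an infinite
   integral, for which the real-valued integral would be the default 0. *)
case: (\int[Pi]_(z in _) _)%E => [S| |]//= [->].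
by congr (_ * _); ring.
Qed.

(** * Optimal stopping *)

(** As [p] can only switch from true to false, it holds on an initial segment, so the sum telescopes
    up to the length of that segment. *)
Lemma sum_stopped (V : pzRingType) (g : nat -> V) (p : nat -> bool) M :
  (forall j, p j.+1 -> p j) ->
  \sum_(j < M) (p j)%:R * (g j.+1 - g j) = g (\sum_(j < M) p j)%N - g 0%N.
Proof.
move=> pS; elim: M => [|M IH]; first by rewrite !big_ord0 subrr.
rewrite !big_ord_recr /= IH; case pM: (p M); last by rewrite addn0 mul0r addr0.
have all_p j : (j <= M)%N -> p j.
  elim: M pM {IH} => [|M IHM] pM; first by rewrite leqn0 => /eqP ->.
  by rewrite leq_eqVlt => /orP[/eqP -> //|]; rewrite ltnS; apply: IHM; exact: pS.
rewrite (eq_bigr (fun=> 1%N)) => [|j _]; last by rewrite all_p// ltnW.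
by rewrite sum1_card card_ord addn1 mul1r addrC addrA subrK.
Qed.

Lemma count_lt_cell (R : realType) (y : R) N : 0 <= y ->
  let S := (\sum_(j < N) (j%:R < y)%R)%N in
  (S <= N)%N /\ S%:R <= y + 1 /\ (y <= S%:R \/ S = N).
Proof.
move=> y0 /=; elim: N => [|N [IH1 [IH2 IH3]]].
  by rewrite big_ord0; split=> //; split; [lra|right].
rewrite big_ord_recr /=; case: ltP => [lt|ge] /=.
  rewrite addn1; case: IH3 => [IH3|->].
    have : (N%:R : R) < (\sum_(j < N) (j%:R < y)%R)%N%:R by lra.
    by rewrite ltr_nat ltnNge IH1.
  split=> //; split; last by right.
  by rewrite -natr1; lra.
rewrite addn0; split; first exact: leq_trans IH1 _.
split=> //; left; case: IH3 => // ->; exact: ge.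
Qed.

Definition gain (T : Type) (R : realType) m (r : R) (y : 'I_m -> R)
    (L : 'I_m -> R -> T -> R) (t : R) (w : T) : R :=
  expR (- (r * t)) * (1 - \sum_(i < m) y i * expR (L i t w)).

(* The gain at the first grid point of mesh [2^-k] that is [>= tau], truncated at the
   horizon [N]. *)
Definition stopped_gain (T : Type) (R : realType) m (r : R) (y : 'I_m -> R)
    (L : 'I_m -> R -> T -> R) (tau : T -> \bar R) (k N : nat) (w : T) : R :=
  gain r y L 0 w + \sum_(j < (N * 2 ^ k)%N) ((j%:R / 2 ^+ k)%:E < tau w)%E%:R *
    (gain r y L (j.+1%:R / 2 ^+ k) w - gain r y L (j%:R / 2 ^+ k) w).

(** Counting the grid points before [tau] gives the index of the first one that is [>= tau], or
    [N * 2^k] if there is none within the horizon. *)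
Definition stop_index (T : Type) (R : realType) (tau : T -> \bar R) (k N : nat) (w : T) : nat :=
  (\sum_(j < (N * 2 ^ k)%N) ((j%:R / 2 ^+ k)%:E < tau w)%E)%N.

Lemma stopped_gainE (T : Type) (R : realType) m (r : R) (y : 'I_m -> R)
    (L : 'I_m -> R -> T -> R) (tau : T -> \bar R) k N w :
  stopped_gain r y L tau k N w = gain r y L ((stop_index tau k N w)%:R / 2 ^+ k) w.
Proof.
rewrite /stopped_gain (@sum_stopped _ (fun j => gain r y L (j%:R / 2 ^+ k) w)
  (fun j => ((j%:R / 2 ^+ k)%:E < tau w)%E)).
  by rewrite mul0r addrCA subrr addr0.
by move=> j; apply: le_lt_trans; rewrite lee_fin; exact: dyadic_step_ge0.
Qed.

Lemma stop_index_fin (T : Type) (R : realType) (tau : T -> \bar R) k N w (t : R) :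
  tau w = t%:E -> 0 <= t -> t <= N%:R ->
  t <= (stop_index tau k N w)%:R / 2 ^+ k <= t + 2 ^- k.
Proof.
move=> tw t0 tN; have k0 := exp2n_gt0 R k.
have y0 : 0 <= t * 2 ^+ k by rewrite mulr_ge0// ltW.
have [h1 [h2 h3]] := count_lt_cell (N * 2 ^ k)%N y0.
have E : stop_index tau k N w = (\sum_(j < (N * 2 ^ k)%N) (j%:R < t * 2 ^+ k)%R)%N.
  by apply: eq_bigr => j _; rewrite tw lte_fin ltr_pdivrMr.
rewrite E ler_pdivlMr// ler_pdivrMr// mulrDl mulVf ?gt_eqF// h2 andbT.
by case: h3 => // ->; rewrite natrM natrX ler_wpM2r// ltW.
Qed.

Lemma stop_index_infty (T : Type) (R : realType) (tau : T -> \bar R) k N w :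
  tau w = +oo%E -> (stop_index tau k N w)%:R / 2 ^+ k = N%:R :> R.
Proof.
move=> tw; rewrite /stop_index (eq_bigr (fun=> 1%N)); last by move=> j _; rewrite tw ltry.
by rewrite sum1_card card_ord natrM natrX mulfK// gt_eqF// exp2n_gt0.
Qed.

Lemma gain_bound d (T : measurableType d) (R : realType) (P : probability T R)
    m (r : R) (y : 'I_m -> R) (L : 'I_m -> R -> T -> R) t w :
  levy_process P L -> (forall i, negative_subordinator P (L i)) ->
  0 <= t -> (forall i, 0 < y i) ->
  `|gain r y L t w| <= expR (- (r * t)) * (1 + \sum_(i < m) y i).
Proof.
move=> hL hs t0 y0; rewrite normrM ger0_norm ?expR_ge0// ler_wpM2l ?expR_ge0//.
apply: (le_trans (ler_normB _ _)); rewrite normr1 lerD2l.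
apply: (le_trans (ler_norm_sum _ _ _)); apply: ler_sum => i _.
have yi := ltW (y0 i).
rewrite normrM !ger0_norm ?expR_ge0// ler_piMr//.
exact: exp_levy_le1 hL hs _ _ _ _.
Qed.

Lemma gain_right_continuous d (T : measurableType d) (R : realType) (P : probability T R)
    m (r : R) (y : 'I_m -> R) (L : 'I_m -> R -> T -> R) t w :
  levy_process P L -> 0 <= t ->
  gain r y L u w @[u --> t^'+] --> gain r y L t w.
Proof.
move=> hL t0; apply: cvgM.
  apply: (@cvg_comp _ _ _ (fun u => - (r * u)) (@expR R) _ (nbhs (- (r * t))));
    last exact: continuous_expR.
  apply: cvgN; apply: cvgM; first exact: cvg_cst.
  exact: cvg_at_right_filter.
apply: cvgB; first exact: cvg_cst.
apply: (@cvg_big_sum _ _ _ _ _ _ (fun i u => y i * expR (L i u w))) => i; apply: cvgM; first exact: cvg_cst.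
apply: (@cvg_comp _ _ _ (fun u => L i u w) (@expR R) _ (nbhs (L i t w)));
  last exact: continuous_expR.
exact: levy_right_continuous hL _ _ _ t0.
Qed.

(** The filter at [t] from the right omits [t] itself, whereas [u n] may be equal to [t]; that case
    is treated apart. *)
Lemma cvg_right_seq (R : realType) (f : R -> R) (t : R) (u : nat -> R) :
  f x @[x --> t^'+] --> f t -> (forall n, t <= u n) -> u n @[n --> \oo] --> t ->
  f (u n) @[n --> \oo] --> f t.
Proof.
move=> ft tu ut; apply/cvgrPdist_lt => e e0.
have /cvgrPdist_lt/(_ e e0) := ft.
rewrite /at_right near_withinE => -[d /= d0 hd].
have /cvgrPdist_lt/(_ d d0) := ut; apply: filterS => n un.
have := tu n; rewrite le_eqVlt => /orP[/eqP <-|lt]; first by rewrite subrr normr0.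
exact: hd.
Qed.

(* Mesh [4^-n] on the horizon [n]: the [n * 4^n] errors of order [16^-n] in
   [stopped_gain_le] then add up to [o(1)]. *)
Lemma cvg_stopped_gain d (T : measurableType d) (R : realType) (P : probability T R)
    m (r : R) (y : 'I_m -> R) (L : 'I_m -> R -> T -> R) (tau : T -> \bar R) w :
  levy_process P L -> (forall i, negative_subordinator P (L i)) ->
  0 < r -> (forall i, 0 < y i) -> (0 <= tau w)%E ->
  stopped_gain r y L tau (n + n) n w @[n --> \oo] --> payoff r y L tau w.
Proof.
move=> hL hs r0 y0; under eq_fun do rewrite stopped_gainE; rewrite /payoff.
case tw: (tau w) => [t| |]// t0.
  rewrite lee_fin in t0.
  (* While the horizon [n] is still below [t] the rounded time may be smaller than [t]; the default
     [t] keeps [t <= u n] for every [n] and does not affect the limit. *)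
  pose u n := if t <= n%:R then (stop_index tau (n + n) n w)%:R / 2 ^+ (n + n) else t : R.
  have ub n : t <= u n <= t + 2 ^- n.
    rewrite /u; case: ifPn => tn.
      have /andP[-> h] := stop_index_fin (n + n) tw t0 tn.
      apply: (le_trans h); rewrite lerD2l lef_pV2 ?posrE ?exp2n_gt0//.
      by rewrite ler_eXn2l ?ltr1n// leq_addr.
    by rewrite lexx lerDl invr_ge0 exprn_ge0.
  have ucvg : u n @[n --> \oo] --> t.
    apply: (@squeeze_cvgr _ _ _ _ (cst t) (fun n => t + 2 ^- n)).
    - by apply: nearW => n; exact: ub.
    - exact: cvg_cst.
    - rewrite -[X in _ --> X]addr0; apply: cvgD; [exact: cvg_cst|exact: cvg_inv_exp2].
  have := cvg_right_seq (@gain_right_continuous _ _ _ P _ r y L t w hL t0) _ ucvg.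
  move=> /(_ (fun n => proj1 (andP (ub n)))).
  apply: cvg_trans; apply: near_eq_cvg; near=> n.
  rewrite /u ifT//; near: n; exact: nbhs_infty_ger.
(* If [tau] is infinite, the gain is taken at the horizon [n], where discounting makes it at most
   [C * exp (- r n)]; this matches the payoff 0. *)
under eq_fun do rewrite (stop_index_infty _ _ tw).
apply/norm_cvg0P.
pose C := 1 + \sum_(i < m) y i.
apply: (@squeeze_cvgr _ _ _ _ (cst 0) (fun n => expR (- r) ^+ n * C)).
- apply: nearW => n; rewrite normr_ge0 /=.
  have -> : expR (- r) ^+ n = expR (- (r * n%:R)) by rewrite -expRM_natl mulrN mulrC.
  exact: gain_bound hL hs (ler0n _ _) y0.
- exact: cvg_cst.
- rewrite -[X in _ --> X](mul0r C); apply: cvgM; last exact: cvg_cst.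
  have := @cvg_geometric R 1 (expR (- r)).
  have lt1 : expR (- r) < 1 by rewrite -expR0 ltr_expR oppr_lt0.
  rewrite ger0_norm ?expR_ge0// => /(_ lt1).
  by apply: cvg_trans; apply: near_eq_cvg; near=> n; rewrite /geometric /= mul1r.
Unshelve. all: by end_near.
Qed.

(** * Expectations of bounded measurable functions *)

Definition bounded_mfun d (T : measurableType d) (R : realType) (f : T -> R) : Prop :=
  measurable_fun [set: T] f /\ exists M, forall w, `|f w| <= M.

Lemma bounded_mfun_integrable d (T : measurableType d) (R : realType)
    (P : probability T R) (f : T -> R) :
  bounded_mfun f -> P.-integrable [set: T] (EFin \o f).
Proof. by move=> [mf [M fM]]; exact: bounded_integrable mf fM. Qed.

Lemma bounded_mfun_cst d (T : measurableType d) (R : realType) (c : R) :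
  bounded_mfun (fun _ : T => c).
Proof. by split => //; exists `|c|. Qed.

Lemma bounded_mfunD d (T : measurableType d) (R : realType) (f g : T -> R) :
  bounded_mfun f -> bounded_mfun g -> bounded_mfun (fun w => f w + g w).
Proof.
move=> [mf [M fM]] [mg [N gN]]; split; first exact: measurable_funD.
by exists (M + N) => w; apply: (le_trans (ler_normD _ _)); rewrite lerD.
Qed.

Lemma bounded_mfunM d (T : measurableType d) (R : realType) (f g : T -> R) :
  bounded_mfun f -> bounded_mfun g -> bounded_mfun (fun w => f w * g w).
Proof.
move=> [mf [M fM]] [mg [N gN]]; split; first exact: measurable_funM.
by exists (M * N) => w; rewrite normrM ler_pM.
Qed.

Lemma bounded_mfunB d (T : measurableType d) (R : realType) (f g : T -> R) :
  bounded_mfun f -> bounded_mfun g -> bounded_mfun (fun w => f w - g w).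
Proof.
move=> [mf [M fM]] [mg [N gN]]; split; first exact: measurable_funB.
by exists (M + N) => w; apply: (le_trans (ler_normB _ _)); rewrite lerD.
Qed.

Lemma bounded_mfun_sum d (T : measurableType d) (R : realType) (I : Type) (s : seq I)
    (f : I -> T -> R) :
  (forall i, bounded_mfun (f i)) -> bounded_mfun (fun w => \sum_(i <- s) f i w).
Proof.
move=> hf; elim: s => [|i s IH].
  under eq_fun do rewrite big_nil; exact: bounded_mfun_cst.
under eq_fun do rewrite big_cons; exact: bounded_mfunD.
Qed.

Lemma bounded_mfun_indic d (T : measurableType d) (R : realType) (A : set T) :
  measurable A -> bounded_mfun (\1_A : T -> R).
Proof.
move=> mA; split; first exact: measurable_indic.
by exists 1 => w; rewrite indicE normr_nat lern1 leq_b1.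
Qed.

Lemma bounded_mfun_exp_levy d (T : measurableType d) (R : realType) (P : probability T R)
    m (L : 'I_m -> R -> T -> R) i t :
  levy_process P L -> (forall i, negative_subordinator P (L i)) -> 0 <= t ->
  bounded_mfun (fun w => expR (L i t w)).
Proof.
move=> hL hs t0; split; first exact: measurable_exp_levy hL _ _ t0.
by exists 1 => w; rewrite ger0_norm ?expR_ge0//; exact: exp_levy_le1 hL hs _ _ _ _.
Qed.

Lemma Rintegral_bounded_sum d (T : measurableType d) (R : realType) (P : probability T R)
    (I : Type) (s : seq I) (f : I -> T -> R) :
  (forall i, bounded_mfun (f i)) ->
  \int[P]_w (\sum_(i <- s) f i w) = \sum_(i <- s) \int[P]_w f i w.
Proof.
move=> hf; elim: s => [|i s IH].
  rewrite big_nil; under eq_Rintegral do rewrite big_nil.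
  by rewrite /Rintegral integral0.
rewrite big_cons -IH; under eq_Rintegral do rewrite big_cons.
apply: RintegralD => //; apply: bounded_mfun_integrable => //.
exact: bounded_mfun_sum.
Qed.

Lemma Rintegral_indicM_bounds d (T : measurableType d) (R : realType) (P : probability T R)
    (A : set T) (f : T -> R) :
  measurable A -> bounded_mfun f -> (forall w, 0 <= f w <= 1) ->
  0 <= \int[P]_w (\1_A w * f w) <= 1.
Proof.
move=> mA bf f01.
have i01 w : 0 <= (\1_A w : R) <= 1 by rewrite indicE; case: (_ \in _); rewrite ?lexx ?ler01.
apply/andP; split.
  by apply: Rintegral_ge0 => w _; case/andP: (f01 w) => *; rewrite mulr_ge0.
have -> : 1 = \int[P]_(w in [set: T]) 1 :> R.
  by rewrite /Rintegral integral_cst//= mul1e probability_setT.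
apply: le_Rintegral => //.
- by apply: bounded_mfun_integrable; apply: bounded_mfunM => //; exact: bounded_mfun_indic.
- by apply: bounded_mfun_integrable; exact: bounded_mfun_cst.
- by move=> w _; case/andP: (f01 w) => *; case/andP: (i01 w) => *; rewrite mulr_ile1.
Qed.

Lemma bounded_mfun_gain d (T : measurableType d) (R : realType) (P : probability T R)
    m (r : R) (y : 'I_m -> R) (L : 'I_m -> R -> T -> R) t :
  levy_process P L -> (forall i, negative_subordinator P (L i)) -> 0 <= t ->
  bounded_mfun (gain r y L t).
Proof.
move=> hL hs t0; apply: bounded_mfunM; first exact: bounded_mfun_cst.
apply: bounded_mfunB; first exact: bounded_mfun_cst.
apply: bounded_mfun_sum => i; apply: bounded_mfunM; first exact: bounded_mfun_cst.
exact: bounded_mfun_exp_levy hL hs t0.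
Qed.

Lemma Rintegral_indic_gain d (T : measurableType d) (R : realType) (P : probability T R)
    m (r : R) (y : 'I_m -> R) (L : 'I_m -> R -> T -> R) t (A : set T) :
  levy_process P L -> (forall i, negative_subordinator P (L i)) -> 0 <= t -> measurable A ->
  \int[P]_w (\1_A w * gain r y L t w) = expR (- (r * t)) *
    (\int[P]_w (\1_A w : R) - \sum_(i < m) y i * \int[P]_w (\1_A w * expR (L i t w))).
Proof.
move=> hL hs t0 mA.
have bA := @bounded_mfun_indic _ T R _ mA.
have bE i := bounded_mfunM bA (bounded_mfun_exp_levy i hL hs t0).
have bS i := bounded_mfunM (bounded_mfun_cst T (y i)) (bE i).
transitivity (\int[P]_w (expR (- (r * t)) *
   (\1_A w - \sum_(i < m) y i * (\1_A w * expR (L i t w))))).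
  apply: eq_Rintegral => w _; rewrite /gain mulrCA mulrBr mulr1 mulr_sumr.
  by congr (_ * (_ - _)); apply: eq_bigr => i _; rewrite mulrCA.
rewrite RintegralZl//; last first.
  by apply: bounded_mfun_integrable; apply: bounded_mfunB => //; exact: bounded_mfun_sum.
rewrite RintegralB//; [|exact: bounded_mfun_integrable|
  by apply: bounded_mfun_integrable; exact: bounded_mfun_sum].
rewrite Rintegral_bounded_sum//; congr (_ * (_ - _)); apply: eq_bigr => i _.
by rewrite RintegralZl//; exact: bounded_mfun_integrable.
Qed.

Lemma Rintegral_indic_drift d (T : measurableType d) (R : realType) (P : probability T R)
    m (r : R) (c : 'I_m -> R) (L : 'I_m -> R -> T -> R) t (A : set T) :
  levy_process P L -> (forall i, negative_subordinator P (L i)) -> 0 <= t -> measurable A ->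
  \int[P]_w (\1_A w * (\sum_(i < m) c i * expR (L i t w) - r)) =
    \sum_(i < m) c i * \int[P]_w (\1_A w * expR (L i t w)) - r * \int[P]_w (\1_A w : R).
Proof.
move=> hL hs t0 mA.
have bA := @bounded_mfun_indic _ T R _ mA.
have bE i := bounded_mfunM bA (bounded_mfun_exp_levy i hL hs t0).
have bS i := bounded_mfunM (bounded_mfun_cst T (c i)) (bE i).
transitivity (\int[P]_w (\sum_(i < m) c i * (\1_A w * expR (L i t w)) - r * \1_A w)).
  apply: eq_Rintegral => w _; rewrite mulrBr mulr_sumr [_ * r]mulrC.
  by congr (_ - _); apply: eq_bigr => i _; rewrite mulrCA.
rewrite RintegralB//; [|by apply: bounded_mfun_integrable; exact: bounded_mfun_sum|
  by apply: bounded_mfun_integrable; apply: bounded_mfunM => //; exact: bounded_mfun_cst].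
rewrite Rintegral_bounded_sum// RintegralZl//; last exact: bounded_mfun_integrable.
congr (_ - _); apply: eq_bigr => i _.
by rewrite RintegralZl//; exact: bounded_mfun_integrable.
Qed.

(** * One-step estimate and comparison of stopping times *)

Lemma gain_increment_bound d (T : measurableType d) (R : realType) (P : probability T R)
    m (r : R) (y phi : 'I_m -> R) (L : 'I_m -> R -> T -> R) (k j : nat) (A : set T) :
  levy_process P L -> (forall i, negative_subordinator P (L i)) ->
  0 < r -> (forall i, 0 < y i) -> (forall i, 0 <= phi i) ->
  (forall i k, mgf P (L i) (2 ^- k) = expR (- (phi i / 2 ^+ k))) ->
  natural_filtration L (j%:R / 2 ^+ k) A ->
  `| \int[P]_w (\1_A w * (gain r y L (j.+1%:R / 2 ^+ k) w - gain r y L (j%:R / 2 ^+ k) w))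
     - 2 ^- k * (expR (- (r * (j%:R / 2 ^+ k))) *
       \int[P]_w (\1_A w * (\sum_(i < m) y i * (r + phi i) * expR (L i (j%:R / 2 ^+ k) w) - r)))|
  <= (r ^+ 2 + \sum_(i < m) y i * (r + phi i) ^+ 2) * (2 ^- k) ^+ 2.
Proof.
move=> hL hs r0 y0 phi0 hphi FA.
set s := j%:R / 2 ^+ k; set dl := 2 ^- k.
have s0 : 0 <= s by rewrite divr_ge0// exprn_ge0.
have dl0 : 0 <= dl by rewrite invr_ge0 exprn_ge0.
have -> : j.+1%:R / 2 ^+ k = s + dl by rewrite -natr1 mulrDl mul1r.
have sd0 : 0 <= s + dl by rewrite addr_ge0.
have mA := natural_filtration_measurable hL FA.
have bA := @bounded_mfun_indic _ T R _ mA.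
have bg t : 0 <= t -> bounded_mfun (fun w => \1_A w * gain r y L t w).
  by move=> t0; apply: bounded_mfunM => //; exact: bounded_mfun_gain hL hs t0.
have -> : \int[P]_w (\1_A w * (gain r y L (s + dl) w - gain r y L s w)) =
    \int[P]_w (\1_A w * gain r y L (s + dl) w) - \int[P]_w (\1_A w * gain r y L s w).
  rewrite -RintegralB//; [|exact: bounded_mfun_integrable (bg _ _)|
    exact: bounded_mfun_integrable (bg _ _)].
  by apply: eq_Rintegral => w _; rewrite mulrBr.
rewrite !(Rintegral_indic_gain _ _ hL hs _ mA)// (Rintegral_indic_drift _ _ hL hs _ mA)//.
have p01 : 0 <= \int[P]_w (\1_A w : R) <= 1.
  have := Rintegral_indicM_bounds P mA (bounded_mfun_cst T (1 : R)) _.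
  by under eq_Rintegral do rewrite mulr1; apply=> _; rewrite ler01 lexx.
have x01 i : 0 <= \int[P]_w (\1_A w * expR (L i s w)) <= 1.
  apply: Rintegral_indicM_bounds => //; first exact: bounded_mfun_exp_levy hL hs s0.
  by move=> w; rewrite expR_ge0; exact: exp_levy_le1 hL hs _ _ _ _.
have xE i : \int[P]_w (\1_A w * expR (L i (s + dl) w)) =
    \int[P]_w (\1_A w * expR (L i s w)) * expR (- (phi i * dl)).
  by rewrite (mgf_increment i hL hs s0 dl0 FA) hphi.
under eq_bigr do rewrite xE.
move: p01 x01; set p := \int[P]_w _ => p01.
move E : (fun i => \int[P]_w (\1_A w * expR (L i s w))) => x.
have {}E i : \int[P]_w (\1_A w * expR (L i s w)) = x i by rewrite -E.
move=> x01; have {}x01 i : 0 <= x i <= 1 by rewrite -E.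
under eq_bigr do rewrite E.
under [\sum_(i < m) y i * \int[P]_w _]eq_bigr do rewrite E.
under [\sum_(i < m) _ * \int[P]_w _]eq_bigr do rewrite E.
(* The second order remainder of [exp_loss]. The first order parts of the increment make up the
   bracket; what remains is [loss2] at [r * dl] for the constant 1 in the gain and at
   [(r + phi i) * dl] for each coordinate. Both groups are nonnegative, so the bounds [u^2] yield
   the two terms of the constant. *)
pose loss2 (u : R) := u - exp_loss u.
have loss2_bounds u : 0 <= u -> 0 <= loss2 u <= u ^+ 2.
  by move=> /exp_loss_bounds[_ _ h1 h2]; rewrite /loss2; apply/andP; split; lra.
pose S4 := \sum_(i < m) y i * loss2 ((r + phi i) * dl) * x i.
set S1 := \sum_(i < m) y i * (x i * _); set S2 := \sum_(i < m) y i * x i.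
set S3 := \sum_(i < m) y i * (r + phi i) * x i.
have S4E : S4 = dl * S3 - S2 + expR (- (r * dl)) * S1.
  rewrite /S4 /S3 /S2 /S1 !mulr_sumr -sumrB -big_split /=; apply: eq_bigr => i _.
  have e : expR (- ((r + phi i) * dl)) = expR (- (r * dl)) * expR (- (phi i * dl)).
    by rewrite -expRD; congr expR; ring.
  rewrite /loss2 /exp_loss e; ring.
have -> : expR (- (r * (s + dl))) = expR (- (r * s)) * expR (- (r * dl)).
  by rewrite -expRD; congr expR; ring.
set e0 := expR (- (r * s)).
have -> : e0 * expR (- (r * dl)) * (p - S1) - e0 * (p - S2) - dl * (e0 * (S3 - r * p)) =
    e0 * (loss2 (r * dl) * p - S4).
  by rewrite S4E /loss2 /exp_loss; ring.
have e01 : 0 <= e0 <= 1.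
  by rewrite expR_ge0 -expR0 ler_expR oppr_le0 mulr_ge0// ltW.
have bnd u v : 0 <= u -> 0 <= v <= 1 -> 0 <= loss2 u * v <= u ^+ 2.
  by move=> /loss2_bounds/andP[l0 l1] /andP[v0 v1]; apply/andP; split; nra.
have rp := bnd (r * dl) p (mulr_ge0 (ltW r0) dl0) p01.
have S40 : 0 <= S4 <= (\sum_(i < m) y i * (r + phi i) ^+ 2) * dl ^+ 2.
  have t i : 0 <= loss2 ((r + phi i) * dl) * x i <= ((r + phi i) * dl) ^+ 2.
    by apply: bnd (x01 i); rewrite mulr_ge0// addr_ge0// ltW.
  apply/andP; split.
    apply: sumr_ge0 => i _; rewrite -[_ * _ * x i]mulrA.
    by apply: mulr_ge0; [exact: ltW|case/andP: (t i)].
  rewrite mulr_suml; apply: ler_sum => i _.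
  rewrite -[leLHS]mulrA -[leRHS]mulrA -exprMn; apply: ler_wpM2l; first exact: ltW.
  by case/andP: (t i).
rewrite normrM ger0_norm; last by case/andP: e01.
apply: (@le_trans _ _ `|loss2 (r * dl) * p - S4|).
  by rewrite ler_piMl//; case/andP: e01.
rewrite [leRHS]mulrDl ler_norml; rewrite exprMn in rp; move: rp S40 => /andP[? ?] /andP[? ?].
by apply/andP; split; lra.
Qed.

Lemma stopping_time_gt d (T : measurableType d) (R : realType) m (L : 'I_m -> R -> T -> R)
    (tau : T -> \bar R) t :
  stopping_time L tau -> 0 <= t -> natural_filtration L t [set w | (t%:E < tau w)%E].
Proof.
move=> [_ htau] t0.
have -> : [set w | (t%:E < tau w)%E] = ~` [set w | (tau w <= t%:E)%E].
  by apply/seteqP; split=> w /=; rewrite ltNge => /negP.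
have mt : @measurable _ (g_sigma_algebraType (filtration_gen L t))
    [set w | (tau w <= t%:E)%E] := htau t t0.
have := measurableC mt; exact.
Qed.

Lemma gain_increment_mfun d (T : measurableType d) (R : realType) (P : probability T R)
    m (r : R) (y : 'I_m -> R) (L : 'I_m -> R -> T -> R) (k j : nat) (A : set T) :
  levy_process P L -> (forall i, negative_subordinator P (L i)) -> measurable A ->
  bounded_mfun (fun w => \1_A w *
    (gain r y L (j.+1%:R / 2 ^+ k) w - gain r y L (j%:R / 2 ^+ k) w)).
Proof.
move=> hL hs mA; apply: bounded_mfunM; first exact: bounded_mfun_indic.
by apply: bounded_mfunB; apply: (bounded_mfun_gain _ _ hL hs); rewrite divr_ge0// exprn_ge0.
Qed.

Lemma stopped_gain_indic (T : Type) (R : realType) m (r : R) (y : 'I_m -> R)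
    (L : 'I_m -> R -> T -> R) (tau : T -> \bar R) k N w :
  stopped_gain r y L tau k N w = gain r y L 0 w + \sum_(j < (N * 2 ^ k)%N)
    \1_[set w | ((j%:R / 2 ^+ k)%:E < tau w)%E] w *
    (gain r y L (j.+1%:R / 2 ^+ k) w - gain r y L (j%:R / 2 ^+ k) w).
Proof.
congr (_ + _); apply: eq_bigr => j _; rewrite indicE; congr (_%:R * _).
by congr nat_of_bool; apply/idP/idP; rewrite inE.
Qed.

Lemma bounded_mfun_stopped_gain d (T : measurableType d) (R : realType) (P : probability T R)
    m (r : R) (y : 'I_m -> R) (L : 'I_m -> R -> T -> R) (tau : T -> \bar R) k N :
  levy_process P L -> (forall i, negative_subordinator P (L i)) -> stopping_time L tau ->
  bounded_mfun (stopped_gain r y L tau k N).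
Proof.
move=> hL hs htau; rewrite (funext (stopped_gain_indic r y L tau k N)).
apply: bounded_mfunD; first exact: bounded_mfun_gain hL hs (lexx _).
apply: bounded_mfun_sum => j; apply: (gain_increment_mfun _ _ _ _ hL hs).
by apply: (natural_filtration_measurable hL); apply: stopping_time_gt; rewrite ?divr_ge0 ?exprn_ge0.
Qed.

Lemma Rintegral_stopped_gain d (T : measurableType d) (R : realType) (P : probability T R)
    m (r : R) (y : 'I_m -> R) (L : 'I_m -> R -> T -> R) (tau : T -> \bar R) k N :
  levy_process P L -> (forall i, negative_subordinator P (L i)) -> stopping_time L tau ->
  \int[P]_w stopped_gain r y L tau k N w = \int[P]_w gain r y L 0 w +
   \sum_(j < (N * 2 ^ k)%N) \int[P]_w (\1_[set w | ((j%:R / 2 ^+ k)%:E < tau w)%E] w *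
    (gain r y L (j.+1%:R / 2 ^+ k) w - gain r y L (j%:R / 2 ^+ k) w)).
Proof.
move=> hL hs htau; under eq_Rintegral do rewrite stopped_gain_indic.
have mA (j : nat) : measurable [set w | ((j%:R / 2 ^+ k)%:E < tau w)%E].
  by apply: (natural_filtration_measurable hL); apply: stopping_time_gt; rewrite ?divr_ge0 ?exprn_ge0.
have bj (j : 'I_(N * 2 ^ k)) := gain_increment_mfun r y k j hL hs (mA j).
rewrite RintegralD//; last 2 first.
- apply: bounded_mfun_integrable; exact: bounded_mfun_gain hL hs (lexx _).
- by apply: bounded_mfun_integrable; exact: bounded_mfun_sum.
by rewrite Rintegral_bounded_sum.
Qed.

(** The last hypothesis says that where exactly one of the two times goes on, the bracket is [>= 0]
    if it is [sigma] and [<= 0] if it is [tau]. So [sigma] wins to first order on each cell. Each of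
    the [N * 2^k] cells costs two errors of size [4^-k] times the constant. *)
Lemma stopped_gain_le d (T : measurableType d) (R : realType) (P : probability T R)
    m (r : R) (y phi : 'I_m -> R) (L : 'I_m -> R -> T -> R) (sigma tau : T -> \bar R) k N :
  levy_process P L -> (forall i, negative_subordinator P (L i)) ->
  0 < r -> (forall i, 0 < y i) -> (forall i, 0 <= phi i) ->
  (forall i k, mgf P (L i) (2 ^- k) = expR (- (phi i / 2 ^+ k))) ->
  stopping_time L sigma -> stopping_time L tau ->
  (forall w t, 0 <= t -> 0 <= ((t%:E < sigma w)%E%:R - (t%:E < tau w)%E%:R) *
    (\sum_(i < m) y i * (r + phi i) * expR (L i t w) - r)) ->
  \int[P]_w stopped_gain r y L tau k N w <= \int[P]_w stopped_gain r y L sigma k N w +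
   2 * (r ^+ 2 + \sum_(i < m) y i * (r + phi i) ^+ 2) * (N%:R / 2 ^+ k).
Proof.
move=> hL hs r0 y0 phi0 hphi hsigma htau hpath.
rewrite !(Rintegral_stopped_gain _ _ _ _ hL hs)// -addrA lerD2l.
set K := r ^+ 2 + _.
have -> : 2 * K * (N%:R / 2 ^+ k) = \sum_(j < (N * 2 ^ k)%N) 2 * K * (2 ^- k) ^+ 2.
  rewrite sumr_const card_ord -[RHS]mulr_natr natrM natrX.
  by field; rewrite gt_eqF// exp2n_gt0.
rewrite -big_split /=; apply: ler_sum => j _.
have tj : 0 <= j%:R / 2 ^+ k :> R by rewrite divr_ge0// exprn_ge0.
have Fs := stopping_time_gt hsigma tj; have Ft := stopping_time_gt htau tj.
have Hs := gain_increment_bound hL hs r0 y0 phi0 hphi Fs.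
have Ht := gain_increment_bound hL hs r0 y0 phi0 hphi Ft.
have ms := natural_filtration_measurable hL Fs; have mt := natural_filtration_measurable hL Ft.
have bd A : measurable A -> bounded_mfun (fun w => \1_A w *
    (\sum_(i < m) y i * (r + phi i) * expR (L i (j%:R / 2 ^+ k) w) - r)).
  move=> mA; apply: bounded_mfunM; first exact: bounded_mfun_indic.
  apply: bounded_mfunB; last exact: bounded_mfun_cst.
  apply: bounded_mfun_sum => i; apply: bounded_mfunM; first exact: bounded_mfun_cst.
  exact: bounded_mfun_exp_levy hL hs tj.
have le : \int[P]_w (\1_[set w | ((j%:R / 2 ^+ k)%:E < tau w)%E] w *
    (\sum_(i < m) y i * (r + phi i) * expR (L i (j%:R / 2 ^+ k) w) - r)) <=
  \int[P]_w (\1_[set w | ((j%:R / 2 ^+ k)%:E < sigma w)%E] w *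
    (\sum_(i < m) y i * (r + phi i) * expR (L i (j%:R / 2 ^+ k) w) - r)).
  apply: le_Rintegral => //; [exact: bounded_mfun_integrable (bd _ mt)|
    exact: bounded_mfun_integrable (bd _ ms)|].
  move=> w _; rewrite -subr_ge0 -mulrBl.
  have inE' (ta : T -> \bar R) : \1_[set w | ((j%:R / 2 ^+ k)%:E < ta w)%E] w =
      ((j%:R / 2 ^+ k)%:E < ta w)%E%:R :> R.
    by rewrite indicE; congr (_%:R); congr nat_of_bool; apply/idP/idP; rewrite inE.
  by rewrite !inE'; exact: hpath.
have e0 : 0 <= 2 ^- k * expR (- (r * (j%:R / 2 ^+ k))).
  by rewrite mulr_ge0 ?expR_ge0// invr_ge0 exprn_ge0.
have := ler_wpM2l e0 le.
move: Hs Ht; rewrite -/K !mulrA !ler_norml => /andP[? ?] /andP[? ?] ?; lra.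
Qed.

(** Dominated convergence with the constant [C] as bound; the payoff is measurable as a pointwise
    limit of stopped gains. *)
Lemma cvg_expectation_stopped_gain d (T : measurableType d) (R : realType)
    (P : probability T R) m (r : R) (y : 'I_m -> R) (L : 'I_m -> R -> T -> R)
    (tau : T -> \bar R) :
  levy_process P L -> (forall i, negative_subordinator P (L i)) ->
  0 < r -> (forall i, 0 < y i) -> stopping_time L tau ->
  P.-integrable [set: T] (EFin \o payoff r y L tau) /\
  \int[P]_w stopped_gain r y L tau (n + n) n w @[n --> \oo] -->
    \int[P]_w payoff r y L tau w.
Proof.
move=> hL hs r0 y0 htau.
have b n := bounded_mfun_stopped_gain r y (n + n) n hL hs htau.
have cv w : stopped_gain r y L tau (n + n) n w @[n --> \oo] --> payoff r y L tau w.
  exact: cvg_stopped_gain hL hs r0 y0 (htau.1 w).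
pose C := 1 + \sum_(i < m) y i.
have bC n w : `|stopped_gain r y L tau (n + n) n w| <= C.
  rewrite stopped_gainE.
  have t0 : 0 <= (stop_index tau (n + n) n w)%:R / 2 ^+ (n + n) :> R.
    by rewrite divr_ge0// exprn_ge0.
  apply: (le_trans (gain_bound r w hL hs t0 y0)).
  have C0 : 0 <= C by rewrite addr_ge0// sumr_ge0// => i _; exact: ltW.
  by rewrite ler_piMl// -expR0 ler_expR oppr_le0 mulr_ge0// ltW.
have mp : measurable_fun [set: T] (payoff r y L tau).
  by apply: (measurable_fun_cvg (h := fun n => stopped_gain r y L tau (n + n) n)) => // n; case: (b n).
have mb n : measurable_fun [set: T] (fun w => (stopped_gain r y L tau (n + n) n w)%:E).
  by apply/measurable_EFinP; case: (b n).
have mpE : measurable_fun [set: T] (fun w => (payoff r y L tau w)%:E).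
  exact/measurable_EFinP.
have ip := bounded_mfun_integrable P (bounded_mfun_cst T C).
have [||ipay _ icv] := dominated_convergence measurableT mb mpE _ ip _.
- apply: aeW => w _; apply/cvg_EFin; first exact: nearW.
  exact: cv.
- by apply: aeW => w n _; rewrite lee_fin; exact: bC.
split => //.
have e : (\int[P]_w (payoff r y L tau w)%:E = (\int[P]_w payoff r y L tau w)%:E)%E.
  by rewrite /Rintegral fineK// integrable_fin_num.
rewrite e in icv; exact: (fine_cvg icv).
Qed.

Lemma expectation_payoff_le d (T : measurableType d) (R : realType) (P : probability T R)
    m (r : R) (y phi : 'I_m -> R) (L : 'I_m -> R -> T -> R) (sigma tau : T -> \bar R) :
  levy_process P L -> (forall i, negative_subordinator P (L i)) ->
  0 < r -> (forall i, 0 < y i) -> (forall i, 0 <= phi i) ->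
  (forall i k, mgf P (L i) (2 ^- k) = expR (- (phi i / 2 ^+ k))) ->
  stopping_time L sigma -> stopping_time L tau ->
  (forall w t, 0 <= t -> 0 <= ((t%:E < sigma w)%E%:R - (t%:E < tau w)%E%:R) *
    (\sum_(i < m) y i * (r + phi i) * expR (L i t w) - r)) ->
  ('E_P[payoff r y L tau] <= 'E_P[payoff r y L sigma])%E.
Proof.
move=> hL hs r0 y0 phi0 hphi hsigma htau hpath.
have [isig cs] := cvg_expectation_stopped_gain hL hs r0 y0 hsigma.
have [it ct] := cvg_expectation_stopped_gain hL hs r0 y0 htau.
rewrite unlock /= -[leLHS]fineK ?integrable_fin_num// -[leRHS]fineK ?integrable_fin_num// lee_fin.
set K := r ^+ 2 + \sum_(i < m) y i * (r + phi i) ^+ 2.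
have K0 : 0 <= K.
  by rewrite addr_ge0 ?sqr_ge0// sumr_ge0// => i _; rewrite mulr_ge0 ?sqr_ge0// ltW.
have cs' : \int[P]_w stopped_gain r y L sigma (n + n) n w + 2 * K * 2 ^- n @[n --> \oo] -->
    \int[P]_w payoff r y L sigma w.
  rewrite -[X in _ --> X]addr0 -[X in _ --> _ + X](mulr0 (2 * K)); apply: cvgD => //.
  by apply: cvgM; [exact: cvg_cst|exact: cvg_inv_exp2].
apply: (ler_cvg_to ct cs'); apply: nearW => n.
apply: (le_trans (stopped_gain_le (n + n) n hL hs r0 y0 phi0 hphi hsigma htau hpath)).
(* The error factor [n / 4^n] is at most [2^-n] because [n < 2^n]. *)
rewrite lerD2l -/K ler_wpM2l ?mulr_ge0// exprD invfM mulrA ler_piMl ?invr_ge0 ?exprn_ge0//.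
by rewrite ler_pdivrMr ?exp2n_gt0// mul1r -natrX ler_nat ltnW// ltn_expl.
Qed.

(** As the [c i] are nonnegative, the weighted sum is nonincreasing in time. If it exceeds [r] at
    [t], right-continuity keeps it above [r] at some [v > t] and monotonicity on all of [[0, v]], so
    the infimum is at least [v]. *)
Lemma threshold_timeP d (T : measurableType d) (R : realType) (P : probability T R)
    m (r : R) (c : 'I_m -> R) (L : 'I_m -> R -> T -> R) w t :
  levy_process P L -> (forall i, negative_subordinator P (L i)) ->
  (forall i, 0 <= c i) -> 0 <= t ->
  (threshold_time r c L w <= t%:E)%E = (\sum_(i < m) c i * expR (L i t w) <= r).
Proof.
move=> hL hs c0 t0; apply/idP/idP => [|h]; last first.
  by apply: ereal_inf_lbound; exists t.
apply: contraLR; rewrite -!ltNge => rX.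
have Xcvg : \sum_(i < m) c i * expR (L i u w) @[u --> t^'+] -->
    \sum_(i < m) c i * expR (L i t w).
  apply: (@cvg_big_sum _ _ _ _ _ _ (fun i u => c i * expR (L i u w))) => i.
  apply: cvgM; first exact: cvg_cst.
  apply: (@cvg_comp _ _ _ (fun u => L i u w) (@expR R) _ (nbhs (L i t w)));
    last exact: continuous_expR.
  exact: levy_right_continuous hL _ _ _ t0.
have Xnd u v : 0 <= u -> u <= v ->
    \sum_(i < m) c i * expR (L i v w) <= \sum_(i < m) c i * expR (L i u w).
  move=> u0 uv; apply: ler_sum => i _; rewrite ler_wpM2l// ler_expR.
  exact: (hs i).2.
have := cvgr_gt _ Xcvg _ rX.
rewrite /at_right near_withinE => -[e /= e0 he].
have [v [tv rv]] : exists v, t < v /\ r < \sum_(i < m) c i * expR (L i v w).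
  exists (t + e / 2); split; first by rewrite ltrDl divr_gt0.
  apply: he => /=; last by rewrite ltrDl divr_gt0.
  rewrite opprD addrA subrr add0r normrN gtr0_norm ?divr_gt0//; lra.
apply: (@lt_le_trans _ _ v%:E); first by rewrite lte_fin.
apply: le_ereal_inf_tmp => _ [s [s0 sr] <-].
rewrite lee_fin leNgt; apply/negP => sv.
by have := Xnd _ _ s0 (ltW sv); rewrite leNgt (le_lt_trans sr rv).
Qed.

(** By [threshold_timeP] the event depends on the values at time [t] alone, which places it in the
    raw filtration. *)
Lemma threshold_stopping_time d (T : measurableType d) (R : realType) (P : probability T R)
    m (r : R) (c : 'I_m -> R) (L : 'I_m -> R -> T -> R) :
  levy_process P L -> (forall i, negative_subordinator P (L i)) ->
  (forall i, 0 <= c i) -> stopping_time L (threshold_time r c L).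
Proof.
move=> hL hs c0; split=> [w|t t0].
  by apply: le_ereal_inf_tmp => _ [s [s0 _] <-]; rewrite lee_fin.
have -> : [set w | (threshold_time r c L w <= t%:E)%E] =
    (fun w => \sum_(i < m) c i * expR (L i t w)) @^-1` `]-oo, r].
  by apply/seteqP; split=> w /=; rewrite (threshold_timeP _ _ hL hs c0 t0) in_itv.
have mX : measurable_fun [set: g_sigma_algebraType (filtration_gen L t)]
    ((fun w => \sum_(i < m) c i * expR (L i t w)) :
      g_sigma_algebraType (filtration_gen L t) -> R).
  apply: measurable_sum => i; apply: measurable_funM => //.
  apply: measurableT_comp => //; apply: measurable_coord_filtration.
  by rewrite t0 lexx.
by have := mX measurableT _ (measurable_itv `]-oo, r]); rewrite setTI.
Qed.

Lemma stopping_time_min d (T : measurableType d) (R : realType)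
    m (L : 'I_m -> R -> T -> R) (tau : T -> \bar R) (H : R) :
  0 < H -> stopping_time L tau -> stopping_time L (fun w => Order.min (tau w) H%:E).
Proof.
move=> H0 [tau0 htau]; split=> [w|t t0].
  by rewrite le_min tau0 lee_fin ltW.
have [Ht|tH] := leP H t.
  rewrite (_ : [set w | _] = [set: T]).
    exact: (@measurableT _ (g_sigma_algebraType (filtration_gen L t))).
  by apply/seteqP; split=> w //= _; rewrite ge_min lee_fin Ht orbT.
rewrite (_ : [set w | _] = [set w | (tau w <= t%:E)%E]); first exact: htau.
by apply/seteqP; split=> w /=; rewrite ge_min lee_fin [H <= t]leNgt tH orbF.
Qed.

Unset Implicit Arguments.

Theorem mainTheorem7 (d : measure_display) (T : measurableType d)
    (R : realType) (P : probability T R) (m : nat) (r : R)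
    (y a : 'I_m -> R) (L : 'I_m -> R -> T -> R)
    (Pi : {measure set (m.-tuple R) -> \bar R})
    (hr : 0 < r) (hy : forall i, 0 < y i)
    (hL : levy_process P L)
    (hLsub : forall i, negative_subordinator P (L i))
    (hPi : is_jump_measure P L Pi)
    (hPi_neg : Pi (~` negative_orthant) = 0%E)
    (hPi_fin : (\int[Pi]_z (Num.min 1 (euclidean_norm z))%:E < +oo)%E)
    (ha : is_drift P L a) (ha_le0 : forall i, a i <= 0) :
  let c := threshold_coef r y a Pi in
  let tau_star := threshold_time r c L in
  let J := fun tau : T -> \bar R => ('E_P[payoff r y L tau])%E in
  optimal_among [set tau | stopping_time L tau] J tau_star /\
  (forall H : R, 0 < H ->
     optimal_among
       [set tau | stopping_time L tau /\ forall w, (tau w <= H%:E)%E] J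
       (fun w => Order.min (tau_star w) H%:E)).
Proof.
move=> c tau_star J.
have /choice[phi hphi] : forall i, exists p, 0 <= p /\
    forall k, mgf P (L i) (2 ^- k) = expR (- (p / 2 ^+ k)).
  by move=> i; have [p p0 hp] := mgf_expR i hL hLsub; exists p.
have phi0 i : 0 <= phi i := (hphi i).1.
have mgfE i k := (hphi i).2 k.
have cE i : c i = y i * (r + phi i).
  exact: threshold_coefE hL hLsub hPi hPi_neg ha ha_le0 (phi0 i) (mgfE i).
have c0 i : 0 <= c i.
  by rewrite cE; apply: mulr_ge0; [exact: ltW|rewrite addr_ge0// ltW].
have st : stopping_time L tau_star := threshold_stopping_time r hL hLsub c0.
have tau_starP w t : 0 <= t -> (t%:E < tau_star w)%E =
    (r < \sum_(i < m) y i * (r + phi i) * expR (L i t w)).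
  move=> t0; rewrite !ltNge (threshold_timeP _ _ hL hLsub c0 t0).
  by congr (~~ (_ <= _)); apply: eq_bigr => i _; rewrite cE.
(* Here [b] is the decision of an arbitrary competitor: going on exactly when [x > r'] is pointwise
   the best decision. *)
have sign (b : bool) (r' x : R) : 0 <= ((r' < x)%R%:R - b%:R) * (x - r').
  case: b; case: ltP => h; rewrite ?subrr ?mul0r ?sub0r ?subr0 ?mul1r//.
  - by rewrite mulN1r opprB subr_ge0.
  - by rewrite subr_ge0 ltW.
split.
  split=> //; apply/eqP; rewrite eq_le; apply/andP; split.
    by apply: ereal_sup_ubound; exists tau_star.
  apply: ge_ereal_sup => _ [tau htau <-].
  apply: (expectation_payoff_le hL hLsub hr hy phi0 mgfE st htau) => w t t0.
  by rewrite tau_starP.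
move=> H H0.
have stH := stopping_time_min H0 st.
have SH : [set tau | stopping_time L tau /\ forall w, (tau w <= H%:E)%E]
    (fun w => Order.min (tau_star w) H%:E).
  by split=> // w; rewrite ge_min lexx orbT.
split=> //; apply/eqP; rewrite eq_le; apply/andP; split.
  by apply: ereal_sup_ubound; eexists; first exact: SH.
apply: ge_ereal_sup => _ [tau [htau tauH] <-].
apply: (expectation_payoff_le hL hLsub hr hy phi0 mgfE stH htau) => w t t0.
(* Before [H] the truncated time decides like [tau_star]; from [H] on both times have stopped and
   the difference of the indicators is 0. *)
rewrite lt_min lte_fin; have [tH|Ht] := ltP t H.
  by rewrite andbT tau_starP.
by rewrite andbF ltNge (le_trans (tauH w))// subrr mul0r.
Qed.
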